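(* Let $\Omega\subset\mathbb{R}^k$ be a connected open set and let $(O_n)_{n\ge1}$ be an admissible sequence of open subsets of $\Omega$. For every integer $n\ge1$ and every continuous function $\phi:\Omega\to(0,\infty)$ there exists a continuous function $\psi:\Omega\to(0,\infty)$ such that the canonical inclusion map $$H_{n,\phi}\to H_{n+1,\psi},\qquad f\mapsto f|_{V_{n+1}},$$ is (well defined and) a compact operator.
   Context: Notation: $z=x+iy\in\mathbb{C}^k$ with $x\in\Omega$, $y\in\mathbb{R}^k$; $\zeta\in\mathbb{C}$; $\arg$ is the principal argument. Admissible sequence: nonvoid open sets $O_n\subset\Omega$ ($n\ge1$) with $O_{n+1}\subset O_n$ and $d(O_{n+1},\Omega\setminus O_n)>0$ for all $n$ ($d$ is the distance between sets). Set $$A_n=\{(z,\zeta)\in\mathbb{C}^k\times\mathbb{C}: x\in\Omega,\ x\notin O_{n+1},\ |\arg\zeta|<\tfrac1n,\ 0<|\zeta|<\tfrac1n,\ |y_i|<\tfrac1n|\zeta|,\ 1\le i\le k\},$$ $$B_n=\{(z,\zeta)\in\mathbb{C}^k\times\mathbb{C}: x\in O_n,\ 0<|\zeta|<\tfrac1n,\ |y_i|<\tfrac1n,\ 1\le i\le k\},$$ and $V_n=A_n\cup B_n$. The $V_n$ are connected open sets, decreasing in $n$. For a continuous $\phi:\Omega\to(0,\infty)$, $H_{n,\phi}$ is the Banach space of holomorphic $f:V_n\to\mathbb{C}$ for which there is a constant $c>0$ with $|f(z,\zeta)|\le c\,\phi(x)/|\zeta|^n$ on $V_n$, with norm $\|f\|_{n,\phi}=\sup_{(z,\zeta)\in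 V_n}|\zeta|^n|f(z,\zeta)|/\phi(x)$. *)

(* Defs.v *)
From HB Require Import structures.
From mathcomp Require Import all_boot all_order all_algebra.
From mathcomp Require Import complex.
From mathcomp Require Import all_classical all_reals all_analysis.

Set Implicit Arguments.
Unset Strict Implicit.
Unset Printing Implicit Defensive.

Import Order.TTheory GRing.Theory Num.Theory.
Import numFieldNormedType.Exports.
Local Open Scope classical_set_scope.
Local Open Scope ring_scope.

Notation normc := ComplexField.Normc.normc.

(* With R[i] a normed space over itself, [differentiable] between normed spaces
   over R[i] is complex (Frechet) differentiability. *)
HB.instance Definition _ (R : realType) := NormedModule.copy R[i] R[i]^o.

Section Geometry.
Context {R : realType}.

(* Principal argument, in ]-pi, pi]; junk value at 0. *)
Definition arg (z : R[i]) : R :=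
  let t := acos (complex.Re z / normc z) in
  if 0 <= complex.Im z then t else - t.

(* The norm of 'rV[R]_k in the library is the sup norm, hence this. *)
Definition eucl_dist k (x y : 'rV[R]_k) : R :=
  Num.sqrt (\sum_i (x 0 i - y 0 i) ^+ 2).

(* +oo when one of the two sets is empty. *)
Definition set_dist k (A B : set 'rV[R]_k) : \bar R :=
  ereal_inf [set (eucl_dist q.1 q.2)%:E | q in A `*` B].

Definition Re_rv k (z : 'rV[R[i]]_k) : 'rV[R]_k := map_mx (@complex.Re R) z.

(* The sequence starts at index 1; its value at 0 is irrelevant. *)
Record admissible_seq k (Omega : set 'rV[R]_k) := AdmissibleSeq {
  adm_fun :> nat -> set 'rV[R]_k;
  adm_nonempty : forall n, (1 <= n)%N -> adm_fun n !=set0;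
  adm_open : forall n, (1 <= n)%N -> open (adm_fun n);
  adm_sub : forall n, (1 <= n)%N -> adm_fun n `<=` Omega;
  adm_decr : forall n, (1 <= n)%N -> adm_fun n.+1 `<=` adm_fun n;
  adm_dist : forall n, (1 <= n)%N ->
    (0 < set_dist (adm_fun n.+1) (Omega `\` adm_fun n))%E }.

(* A continuous function Omega -> ]0, +oo[, represented by a total function
   whose values outside Omega are irrelevant. *)
Record weight k (Omega : set 'rV[R]_k) := Weight {
  weight_fun :> 'rV[R]_k -> R;
  weight_continuous : {within Omega, continuous weight_fun};
  weight_gt0 : forall x, Omega x -> 0 < weight_fun x }.

Section Domains.
Context {k : nat} {Omega : set 'rV[R]_k}.
Variables (O : admissible_seq Omega) (n : nat).

Definition dom_A : set ('rV[R[i]]_k * R[i]) :=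
  [set p | [/\ Omega (Re_rv p.1) /\ ~ O n.+1 (Re_rv p.1),
               `|arg p.2| < n%:R^-1,
               0 < normc p.2 < n%:R^-1 &
               forall i, `|complex.Im (p.1 0 i)| < n%:R^-1 * normc p.2]].

Definition dom_B : set ('rV[R[i]]_k * R[i]) :=
  [set p | [/\ O n (Re_rv p.1),
               0 < normc p.2 < n%:R^-1 &
               forall i, `|complex.Im (p.1 0 i)| < n%:R^-1]].

Definition dom_V := dom_A `|` dom_B.

Lemma dom_V_Omega p : dom_V p -> Omega (Re_rv p.1).
Proof.
case=> [[[]//]|[Op np _]]; apply: (adm_sub (n := n)) Op.
by case: n np => [|//]; rewrite invr0 => /andP[/lt_trans/[apply]]; rewrite ltxx.
Qed.

Lemma dom_V_normc_gt0 p : dom_V p -> 0 < normc p.2.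
Proof. by case=> -[_]; [move=> _ /andP[]|move=> /andP[]]. Qed.

End Domains.

Definition holomorphic_on k (V : set ('rV[R[i]]_k * R[i]))
    (f : 'rV[R[i]]_k * R[i] -> R[i]) :=
  forall p, V p -> differentiable f p.

End Geometry.

Section HSpace.
Context {R : realType} {k : nat} {Omega : set 'rV[R]_k}.
Variables (O : admissible_seq Omega) (n : nat) (phi : weight Omega).
Local Notation C := R[i].
Local Notation E := ('rV[C]_k * C)%type.
Local Notation V := (dom_V O n).

Let phi_gt0 p : V p -> 0 < phi (Re_rv p.1).
Proof. by move=> /dom_V_Omega/(weight_gt0 phi). Qed.

(* A function V -> C is represented by its extension by 0 to the whole space;
   V being open, this does not affect differentiability at the points of V. *)
Definition in_H (f : E -> C) : Prop :=
  [/\ forall p, ~ V p -> f p = 0,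
      holomorphic_on V f &
      exists2 c : R, 0 < c &
        forall p, V p -> normc (f p) <= c * phi (Re_rv p.1) / normc p.2 ^+ n].

Definition H_pred : {pred (E -> C)} := mem [set f | in_H f].

Lemma H_predP f : reflect (in_H f) (f \in H_pred).
Proof. by apply: (iffP idP) => [/set_mem|/mem_set]. Qed.

Let bound_gt0 p : V p -> 0 < phi (Re_rv p.1) / normc p.2 ^+ n.
Proof. by move=> Vp; rewrite divr_gt0 ?phi_gt0 ?exprn_gt0 ?(dom_V_normc_gt0 Vp). Qed.

Let normc_ge0 (z : C) : 0 <= normc z.
Proof. by case: z => *; exact: sqrtr_ge0. Qed.

Let H_submod : submod_closed H_pred.
Proof.
split.
  apply/H_predP; split=> //.
  exists 1 => // p Vp; rewrite mul1r [normc _]ComplexField.Normc.normc0.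
  exact/ltW/bound_gt0.
move=> a f g /H_predP[f0 df [c c0 fc]] /H_predP[g0 dg [d d0 gd]].
apply/H_predP; split.
- by move=> p Vp; rewrite /GRing.add/= /GRing.scale/= f0 // g0 // scaler0 addr0.
- move=> p Vp; apply: differentiableD; last exact: dg.
  by apply: differentiableZ; exact: df.
- exists (normc a * c + d); first by rewrite ltr_wpDl ?mulr_ge0 ?(ltW c0).
  move=> p Vp; apply: (le_trans (le_normcD _ _)).
  rewrite !mulrDl lerD ?gd// ComplexField.Normc.normcM -!mulrA.
  by rewrite ler_wpM2l// !mulrA fc.
Qed.

HB.instance Definition _ := GRing.isSubmodClosed.Build C (E -> C) H_pred H_submod.

Record H := MkH { H_fun :> E -> C; _ : H_fun \in H_pred }.

HB.instance Definition _ := [isSub for H_fun].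
HB.instance Definition _ := [Choice of H by <:].
HB.instance Definition _ := [SubChoice_isSubLmodule of H by <:].

Lemma H_in (f : H) : in_H f.
Proof. exact/H_predP/(valP f). Qed.

Lemma H_eq (f g : H) : (forall p, V p -> f p = g p) -> f = g.
Proof.
move=> fg; apply/val_inj/funext => p /=.
have [/fg//|nVp] := pselect (V p).
by have [-> // _ _] := H_in f; have [-> // _ _] := H_in g.
Qed.

Definition H_norm (f : H) : R :=
  sup [set normc p.2 ^+ n * normc (f p) / phi (Re_rv p.1) | p in V].

Let H_normC (f : H) : C := (H_norm f)%:C%C.

Lemma H_norm_ub (f : H) (p : E) : V p ->
  normc p.2 ^+ n * normc (f p) / phi (Re_rv p.1) <= H_norm f.
Proof.
move=> Vp; apply: ub_le_sup; last by exists p.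
have [_ _ [c c0 fc]] := H_in f; exists c => _ [q Vq <-].
have z0 := dom_V_normc_gt0 Vq.
by rewrite ler_pdivrMr ?phi_gt0// mulrC -ler_pdivlMr ?exprn_gt0// fc.
Qed.

Lemma H_norm_le (f : H) (a : R) : 0 <= a ->
  (forall p, V p -> normc p.2 ^+ n * normc (f p) / phi (Re_rv p.1) <= a) ->
  H_norm f <= a.
Proof.
move=> a0 fa; rewrite /H_norm; set A := [set _ | _ in _].
have [->|A0] := eqVneq A set0; first by rewrite sup0.
by apply: ge_sup; [exact/set0P|move=> _ [p Vp <-]; exact: fa].
Qed.

Lemma H_norm_ge0 (f : H) : 0 <= H_norm f.
Proof.
rewrite /H_norm; set A := [set _ | _ in _].
have [->|/set0P[_ [p Vp _]]] := eqVneq A set0; first by rewrite sup0.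
apply: le_trans (H_norm_ub f Vp).
by rewrite divr_ge0 ?mulr_ge0 ?exprn_ge0 ?(ltW (phi_gt0 Vp)).
Qed.

Let H_normD (f g : H) : H_normC (f + g) <= H_normC f + H_normC g.
Proof.
rewrite /H_normC -rmorphD lecR; apply: H_norm_le => [|p Vp].
  by rewrite addr_ge0 ?H_norm_ge0.
apply: le_trans (lerD (H_norm_ub f Vp) (H_norm_ub g Vp)).
rewrite -mulrDl -mulrDr ler_wpM2r ?invr_ge0 ?(ltW (phi_gt0 Vp))//.
by rewrite ler_wpM2l ?exprn_ge0// le_normcD.
Qed.

Let H_norm_leZ (a : C) (f : H) : H_norm (a *: f) <= normc a * H_norm f.
Proof.
apply: H_norm_le => [|p Vp]; first by rewrite mulr_ge0 ?H_norm_ge0.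
have -> : normc ((a *: f) p) = normc a * normc (f p).
  exact: ComplexField.Normc.normcM.
rewrite mulrCA -mulrA ler_wpM2l//.
exact: H_norm_ub.
Qed.

Let H_normZ (a : C) (f : H) : H_normC (a *: f) = `|a| * H_normC f.
Proof.
have -> : `|a| = (normc a)%:C%C by case: a => *; rewrite normc_def.
rewrite /H_normC -rmorphM; congr (_%:C)%C; apply/le_anti/andP; split=> //.
have [->|a0] := eqVneq a 0.
  by rewrite ComplexField.Normc.normc0 mul0r H_norm_ge0.
rewrite -{1}(scalerK a0 f) -ler_pdivlMl; last first.
  rewrite lt0r normc_ge0 andbT; apply: contra a0.
  by move=> /eqP/ComplexField.Normc.eq0_normc ->.
by rewrite -ComplexField.Normc.normcV.
Qed.

Let H_norm_eq0 (f : H) : H_normC f = 0 -> f = 0.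
Proof.
move=> [f0]; apply: H_eq => p Vp.
have := H_norm_ub f Vp; rewrite f0 pmulr_lle0 ?invr_gt0 ?phi_gt0//.
rewrite pmulr_rle0 ?exprn_gt0 ?(dom_V_normc_gt0 Vp)// => fp0.
by apply: ComplexField.Normc.eq0_normc; apply/le_anti; rewrite fp0 normc_ge0.
Qed.

(* The norm of the library is valued in the scalar field R[i]. *)
HB.instance Definition _ :=
  Lmodule_isNormed.Build C H H_normD H_normZ H_norm_eq0.

Lemma H_normE (f : H) : `|f| = (H_norm f)%:C%C.
Proof. by []. Qed.

End HSpace.

Definition compact_operator (K : numFieldType) (X Y : normedModType K)
    (T : X -> Y) :=
  forall A : set X, bounded_set A -> compact (closure (T @` A)).

(* Main.v *)
Require Import Defs.
From HB Require Import structures.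
From mathcomp Require Import all_boot all_order all_algebra.
From mathcomp Require Import complex.
From mathcomp Require Import all_classical all_reals all_analysis.
From mathcomp Require Import ring lra.

(** A bounded family in [H_{n,phi}] has, along any ultrafilter, a pointwise
    limit [g], by compactness of discs.  Schwarz' lemma on complex lines makes
    the family locally equi-Lipschitz, so convergence is locally uniform; Schwarz'
    lemma for the increments [f (. + h) - f] bounds second differences by
    [O(|h|^2)], and summing them dyadically gives a second order Taylor bound
    that is uniform on the family, hence passes to [g]: [g] is holomorphic.  The
    closure of [V_{n+1}] meets [Omega x C^*] inside [V_n], and with
    [psi = (1 + phi) (1 + |x| + 1 / d(x, boundary))] the weighted difference is
    small off a compact set, because of [phi / psi] in [x] and of the extra factor
    [|zeta|] near [zeta = 0].  So the image of each ball of [H_{n,phi}] is compact.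

    Schwarz' lemma is obtained for functions that are merely complex
    differentiable, without integrals.  Goursat's bisection is run on dyadic
    midpoint sums; it gives a primitive [F] with a second order expansion at each
    point, hence [F z = average of F (z + i^j d)] up to [o(d^2)].  This suffices
    for the maximum principle for [(F (z + h) - F z) / h], which tends to [f].
    Applying the maximum principle to [(f - f 0)^(m+1) / t^m] and letting [m] tend
    to infinity replaces the removable singularity of [(f - f 0) / t]. *)

Set Implicit Arguments.
Unset Strict Implicit.

Import Order.TTheory GRing.Theory Num.Theory.
Import numFieldNormedType.Exports.
Local Open Scope classical_set_scope.
Local Open Scope ring_scope.

(** * Real-valued moduli and norms *)

Lemma fmap_ultra (T U : Type) (f : T -> U) (F : set_system T) :
  UltraFilter F -> UltraFilter (f @ F).
Proof.
move=> UF; split=> [|G PG FG]; first exact: fmap_proper_filter.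
apply/seteqP; split=> [A GA|]; last exact: FG.
have [//|FnA] := in_ultra_setVsetC (f @^-1` A) UF.
have /FG GnA : (f @ F) (~` A) by [].
by have [? []] := filter_ex (filterI GA GnA).
Qed.

Lemma ler_eps (R : realType) (x y : R) :
  (forall e : R, 0 < e -> x <= y + e) -> x <= y.
Proof. by move=> h; apply/ler_addgt0Pr. Qed.

Lemma ler_refl_eq (R : realType) (x y : R) : x = y -> x <= y.
Proof. by move=> ->. Qed.

Section Normc.
Context {R : realType}.
Local Notation C := R[i].
Implicit Types z w : C.

Definition cabs z : R := normc z.

Lemma cabs_ge0 z : 0 <= cabs z.
Proof. by case: z => *; exact: sqrtr_ge0. Qed.

Lemma cabs0 : cabs 0 = 0.
Proof. exact: ComplexField.Normc.normc0. Qed.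

Lemma cabs1 : cabs 1 = 1.
Proof. exact: ComplexField.Normc.normc1. Qed.

Lemma cabsM z w : cabs (z * w) = cabs z * cabs w.
Proof. exact: ComplexField.Normc.normcM. Qed.

Lemma cabsV z : cabs z^-1 = (cabs z)^-1.
Proof. exact: ComplexField.Normc.normcV. Qed.

Lemma cabsN z : cabs (- z) = cabs z.
Proof. exact: normcN. Qed.

Lemma le_cabsD z w : cabs (z + w) <= cabs z + cabs w.
Proof. exact: le_normcD. Qed.

Lemma cabs_gt0 z : (0 < cabs z) = (z != 0).
Proof.
rewrite lt0r cabs_ge0 andbT; apply/idP/idP; apply: contra => /eqP.
  by move=> ->; rewrite cabs0.
by move/ComplexField.Normc.eq0_normc ->.
Qed.

Lemma cabsX z n : cabs (z ^+ n) = cabs z ^+ n.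
Proof.
by elim: n => [|n IH]; rewrite ?expr0 ?cabs1// !exprS cabsM IH.
Qed.

Lemma cabsBC z w : cabs (z - w) = cabs (w - z).
Proof. by rewrite -cabsN opprB. Qed.

Lemma ler_cabsB z w : cabs z <= cabs w + cabs (z - w).
Proof. by rewrite -{1}(subrK w z) addrC; exact: le_cabsD. Qed.

Lemma cabs_real (x : R) : cabs x%:C%C = `|x|.
Proof. by rewrite /cabs /= expr0n addr0 sqrtr_sqr. Qed.

Lemma cabs_nat n : cabs n%:R = n%:R.
Proof. by rewrite -(rmorph_nat (real_complex R)) cabs_real normr_nat. Qed.

Lemma cabs_i : cabs 'i%C = 1.
Proof. by rewrite /cabs /= expr0n expr1n add0r sqrtr1. Qed.

Lemma cabs_Re z : `|complex.Re z| <= cabs z.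
Proof.
by case: z => a b; rewrite -sqrtr_sqr ler_wsqrtr//= lerDl sqr_ge0.
Qed.

Lemma cabs_Im z : `|complex.Im z| <= cabs z.
Proof.
by case: z => a b; rewrite -sqrtr_sqr ler_wsqrtr//= lerDr sqr_ge0.
Qed.

Lemma cabs_half z : cabs (z / 2) = cabs z / 2.
Proof. by rewrite cabsM cabsV cabs_nat. Qed.

Lemma cabsE z : `|z| = (cabs z)%:C%C.
Proof. by case: z => *; rewrite normc_def. Qed.

(* The norm of a space over [R[i]] is valued in [R[i]]. *)
Definition nrm {V : normedModType C} (v : V) : R := complex.Re `|v|.

Section Nrm.
Context {V : normedModType C}.
Implicit Types u v : V.

Lemma normE v : `|v| = (nrm v)%:C%C.
Proof. by rewrite /nrm RRe_real// normr_real. Qed.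

Lemma nrm_ge0 v : 0 <= nrm v.
Proof. by rewrite -lecR -normE normr_ge0. Qed.

Lemma nrm0 : nrm (0 : V) = 0.
Proof. by apply: complexI; rewrite -normE normr0. Qed.

Lemma nrm_gt0 v : (0 < nrm v) = (v != 0).
Proof. by rewrite -ltcR -normE normr_gt0. Qed.

Lemma nrmD u v : nrm (u + v) <= nrm u + nrm v.
Proof. by rewrite -lecR rmorphD/= -!normE ler_normD. Qed.

Lemma nrmZ (a : C) u : nrm (a *: u) = cabs a * nrm u.
Proof. by apply: complexI; rewrite rmorphM/= -!normE normrZ; congr (_ * _); exact: cabsE. Qed.

(** A positive element of [R[i]] is real, so real radii describe the same neighbourhoods. *)
Lemma nbhs_nrmP (p : V) (A : set V) :
  nbhs p A <-> exists2 e : R, 0 < e & forall q, nrm (q - p) < e -> A q.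
Proof.
split.
  move=> /nbhs_ballP[e /= e0 eA].
  have er : e = (complex.Re e)%:C%C by rewrite RRe_real// gtr0_real.
  exists (complex.Re e); first by rewrite -ltcR -er.
  move=> q pq; apply: eA; rewrite -ball_normE /= -opprB normrN normE er ltcR.
  exact: pq.
move=> [e e0 eA]; apply/nbhs_ballP; exists e%:C%C; first by rewrite /= ltcR.
move=> q; rewrite -ball_normE /= -opprB normrN normE ltcR; exact: eA.
Qed.

End Nrm.

Lemma nrmc z : nrm z = cabs z.
Proof. by rewrite /nrm -[`|z|]/(`|z : C|) cabsE. Qed.

(** Along an ultrafilter, real and imaginary parts converge because they stay in a segment; the
    limit remains in the disc because [cabs] is continuous. *)
Lemma compact_disc (M : R) : compact [set z : C | cabs z <= M].
Proof.
rewrite compact_ultra => F UF FM.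
have cvg_part (h : C -> R) : (forall z, `|h z| <= cabs z) ->
    exists2 x : R, True & h @ F --> x.
  move=> hle.
  have := @segment_compact R (- M) M; rewrite compact_ultra.
  have hF : F (h @^-1` `[- M, M]).
    apply: filterS FM => z /= zM; rewrite in_itv/= -ler_norml.
    exact: (le_trans (hle z) zM).
  move=> /(_ _ (fmap_ultra h UF) hF) [].
  by move=> x [_ ?]; exists x.
have [a _ Fa] := cvg_part _ cabs_Re.
have [b _ Fb] := cvg_part _ cabs_Im.
have Fab : F --> Complex a b.
  move=> A /nbhs_nrmP[e e0 eA].
  have e20 : 0 < e / 2 by rewrite divr_gt0.
  have Na : F (@complex.Re R @^-1` ball a (e / 2)) := Fa _ (nbhsx_ballx a _ e20).
  have Nb : F (@complex.Im R @^-1` ball b (e / 2)) := Fb _ (nbhsx_ballx b _ e20).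
  apply: filterS (filterI Na Nb) => z [/=]; rewrite /ball /= => za zb.
  apply: eA; rewrite nrmc.
  have -> : z - Complex a b =
      (complex.Re z - a)%:C%C + 'i%C * (complex.Im z - b)%:C%C.
    by case: z {za zb} => x y; simpc.
  apply: le_lt_trans (le_cabsD _ _) _.
  rewrite cabsM !cabs_real cabs_i.
  by move: za zb; rewrite -(normrN (a - _)) -(normrN (b - _)) !opprB; lra.
exists (Complex a b); split => //=.
rewrite leNgt; apply/negP => MN.
have /Fab FN : nbhs (Complex a b) [set z | M < cabs z].
  apply/nbhs_nrmP; exists (cabs (Complex a b) - M) => [|q]; first by rewrite subr_gt0.
  rewrite nrmc /= => qab.
  by have := ler_cabsB (Complex a b) q; rewrite cabsBC /=; lra.
have [z [/= z1 z2]] := filter_ex (filterI FM FN).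
by move: (le_lt_trans z1 z2); rewrite ltxx.
Qed.

End Normc.

(** * Goursat's lemma *)

Section Goursat.
Context {R : realType}.
Local Notation C := R[i].
Implicit Types (f g : C -> C) (a b c z w : C).

(* Substitute for the integral of [f] over the segment [a, b]: the midpoint rule
   is exact on affine functions, and the sums are additive under bisection. *)
Fixpoint isum f n a b : C :=
  if n is n'.+1 then isum f n' a ((a + b) / 2) + isum f n' ((a + b) / 2) b
  else f ((a + b) / 2) * (b - a).

Lemma isum_sub f g n a b :
  isum (fun z => f z - g z) n a b = isum f n a b - isum g n a b.
Proof.
by elim: n a b => [|n IH] a b /=; [ring|rewrite !IH; ring].
Qed.

Lemma isum_affine u v n a b :
  isum (fun z => u + v * z) n a b = u * (b - a) + v * (b ^+ 2 - a ^+ 2) / 2.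
Proof. by elim: n a b => [|n IH] a b /=; rewrite ?IH; field. Qed.

Lemma isum_antisym f n a b : isum f n b a = - isum f n a b.
Proof.
elim: n a b => [|n IH] a b /=; first by rewrite (addrC b); ring.
by rewrite (addrC b) [isum f n b _]IH [isum f n _ a]IH; ring.
Qed.

(** The sums sample [f] only at iterated midpoints of the end points, so closure under midpoints is
    the right form of convexity here. *)
Definition midconvex (K : set C) := forall a b, K a -> K b -> K ((a + b) / 2).

Lemma midconvex_disc c (d : R) : midconvex [set z | cabs (z - c) <= d].
Proof.
move=> a b /= Ka Kb.
have -> : (a + b) / 2 - c = (a - c) / 2 + (b - c) / 2 by field.
by apply: le_trans (le_cabsD _ _) _; rewrite !cabs_half; lra.
Qed.

Lemma isum_bound f (K : set C) (e : R) n a b : midconvex K ->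
  (forall z, K z -> cabs (f z) <= e) -> K a -> K b ->
  cabs (isum f n a b) <= e * cabs (b - a).
Proof.
move=> cK fe; elim: n a b => [|n IH] a b Ka Kb /=.
  by rewrite cabsM ler_wpM2r ?cabs_ge0 ?fe//; exact: cK.
have Km := cK _ _ Ka Kb.
apply: le_trans (le_cabsD _ _) _.
apply: le_trans (lerD (IH _ _ Ka Km) (IH _ _ Km Kb)) _.
have -> : (a + b) / 2 - a = (b - a) / 2 by field.
have -> : b - (a + b) / 2 = (b - a) / 2 by field.
by rewrite -mulrDr cabs_half -splitr.
Qed.

Lemma isum_near_affine f (K : set C) (e : R) u v n a b : midconvex K ->
  (forall z, K z -> cabs (f z - (u + v * z)) <= e) -> K a -> K b ->
  cabs (isum f n a b - (u * (b - a) + v * (b ^+ 2 - a ^+ 2) / 2))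
    <= e * cabs (b - a).
Proof.
move=> cK fe Ka Kb; rewrite -(isum_affine u v n) -isum_sub.
exact: isum_bound cK fe Ka Kb.
Qed.

Definition cdiff f z d := forall e : R, 0 < e -> exists2 del : R, 0 < del &
  forall h, cabs h < del -> cabs (f (z + h) - f z - d * h) <= e * cabs h.

Definition holo_disc f (r : R) := forall z, cabs z < r -> exists d, cdiff f z d.

(** Substitute for the contour integral of [f] along the boundary of the triangle. *)
Definition tsum f n (T : C * C * C) :=
  let: (a, b, c) := T in isum f n a b + isum f n b c + isum f n c a.

Definition tri_in (s r : R) (T : C * C * C) :=
  let: (a, b, c) := T in
  [/\ cabs a <= r, cabs b <= r & cabs c <= r] /\
  [/\ cabs (b - a) <= s, cabs (c - b) <= s & cabs (a - c) <= s].

Definition sub_tri (T : C * C * C) (i : 'I_4) : C * C * C :=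
  let: (a, b, c) := T in
  let ab := (a + b) / 2 in let bc := (b + c) / 2 in let ca := (c + a) / 2 in
  match val i with
  | 0 => (a, ab, ca) | 1 => (b, bc, ab) | 2 => (c, ca, bc) | _ => (ab, bc, ca)
  end.

(** Each inner edge is run through twice, in opposite directions, and cancels by [isum_antisym]; the
    halves of the outer edges add up to the original sides. *)
Lemma tsumS f n T : tsum f n.+1 T = \sum_i tsum f n (sub_tri T i).
Proof.
case: T => [[a b] c]; rewrite !big_ord_recl big_ord0 /=.
rewrite [isum f n ((c + a) / 2) ((b + c) / 2)]isum_antisym.
rewrite [isum f n ((a + b) / 2) ((c + a) / 2)]isum_antisym.
rewrite [isum f n ((b + c) / 2) ((a + b) / 2)]isum_antisym.
ring.
Qed.

(** The bound on the displacement of the first vertex makes the first vertices of a nested sequence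
    of triangles a Cauchy sequence. *)
Lemma sub_tri_in s r T i : tri_in s r T ->
  tri_in (s / 2) r (sub_tri T i) /\ cabs ((sub_tri T i).1.1 - T.1.1) <= s.
Proof.
case: T => [[a b] c] [[Ka Kb Kc] [ab bc ca]].
have mid u v : cabs u <= r -> cabs v <= r -> cabs ((u + v) / 2) <= r.
  move=> ur vr; have := @midconvex_disc 0 r u v; rewrite /= !subr0.
  exact.
have ba : cabs (a - b) <= s by rewrite cabsBC.
have cb : cabs (b - c) <= s by rewrite cabsBC.
have ac : cabs (c - a) <= s by rewrite cabsBC.
have s0 : 0 <= s := le_trans (cabs_ge0 _) ab.
have half u w : cabs u <= s -> w = u / 2 :> C -> cabs w <= s / 2.
  by move=> us ->; rewrite cabs_half ler_pM2r.
have half' u w : cabs u <= s -> w = u / 2 :> C -> cabs w <= s.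
  by move=> us /(half u w us) /le_trans; apply; lra.
case: i => -[|[|[|i]]] /= _; (split; first (split; split; try exact: mid)) => //.
all: try (by rewrite subrr cabs0).
all: try (by apply: (half (b - a)) => //; field).
all: try (by apply: (half (c - b)) => //; field).
all: try (by apply: (half (a - c)) => //; field).
all: try (by apply: (half (a - b)) => //; field).
all: try (by apply: (half (b - c)) => //; field).
all: try (by apply: (half (c - a)) => //; field).
by apply: (half' (b - a)) => //; field.
Qed.

(** The sums of an affine function around a closed triangle vanish, so only the error [e] times the
    length of each of the three sides is left. *)
Lemma tsum_near_affine f (K : set C) (e s r : R) u v n (T : C * C * C) :
  midconvex K -> (forall z, K z -> cabs (f z - (u + v * z)) <= e) ->
  0 <= e -> tri_in s r T -> K T.1.1 -> K T.1.2 -> K T.2 ->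
  cabs (tsum f n T) <= 3 * e * s.
Proof.
move=> cK fe e0; case: T => [[a b] c] [_ [ab bc ca]] /= Ka Kb Kc.
have := isum_near_affine n cK fe Ka Kb.
have := isum_near_affine n cK fe Kb Kc.
have := isum_near_affine n cK fe Kc Ka.
set X := (X in cabs X <= _ -> _ -> _ -> _).
set Y := (X in _ -> cabs X <= _ -> _ -> _).
set Z := (X in _ -> _ -> cabs X <= _ -> _) => hX hY hZ.
have -> : isum f n a b + isum f n b c + isum f n c a = Z + Y + X.
  by rewrite /X /Y /Z; field.
apply: le_trans (le_cabsD _ _) _.
apply: le_trans (lerD (le_cabsD _ _) (lexx _)) _.
have := ler_wpM2l e0 ab; have := ler_wpM2l e0 bc; have := ler_wpM2l e0 ca.
lra.
Qed.

Definition bad f e T := forall N, exists2 n, (N <= n)%N & e < cabs (tsum f n T).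

Lemma bad_sub f (e : R) T : bad f e T -> exists i, bad f (e / 4) (sub_tri T i).
Proof.
move=> badT; apply: contrapT => /forallNP nbad.
have /choice[N HN] : forall i : 'I_4, exists N, forall n, (N <= n)%N ->
    cabs (tsum f n (sub_tri T i)) <= e / 4.
  move=> i; move: (nbad i) => /existsNP[N nN]; exists N => n Nn.
  by rewrite leNgt; apply/negP => en; apply: nN; exists n.
(* The successor accounts for the level of depth that [tsumS] consumes. *)
have [[|n] // Nn] := badT (\max_i N i).+1.
rewrite tsumS ltNge; apply/negP; rewrite negbK.
have {}HN i : cabs (tsum f n (sub_tri T i)) <= e / 4.
  by apply: HN; apply: leq_trans (leq_bigmax i) _.
rewrite !big_ord_recl big_ord0 addr0.
apply: le_trans (le_cabsD _ _) _.
apply: le_trans (lerD (lexx _) (le_cabsD _ _)) _.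
apply: le_trans (lerD (lexx _) (lerD (lexx _) (le_cabsD _ _))) _.
apply: le_trans (lerD (HN _) (lerD (HN _) (lerD (HN _) (HN _)))) _.
lra.
Qed.

(** Goursat's bisection: a bad triangle contains a bad quarter, and so on. The triangles shrink to a
    point [p], where [f] is affine up to a small multiple of the distance; this makes the sums
    smaller than badness allows. *)
Lemma cauchy_goursat f (r rho s e : R) T : holo_disc f r -> rho < r -> 0 < s ->
  tri_in s rho T -> 0 < e ->
  exists N, forall n, (N <= n)%N -> cabs (tsum f n T) <= e.
Proof.
move=> hf rr s0 Ts e0; apply: contrapT => nN.
have badT : bad f e T.
  move=> N; apply: contrapT => nn; apply: nN; exists N => n Nn.
  by rewrite leNgt; apply/negP => en; apply: nn; exists n.
pose P n T := bad f (e / 4 ^+ n) T /\ tri_in (s / 2 ^+ n) rho T.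
have /choice[F FP] : forall x : nat * (C * C * C), exists y, P x.1 x.2 ->
    P x.1.+1 y /\ cabs (y.1.1 - x.2.1.1) <= s / 2 ^+ x.1.
  move=> -[n U] /=.
  have [[bU tU]|] := pselect (P n U); last by exists U.
  have [i bi] := bad_sub bU; have [ti di] := sub_tri_in i tU.
  exists (sub_tri U i) => _; split => //; split; rewrite exprSr invfM mulrA //.
pose U := fix U n := if n is n'.+1 then F (n', U n') else T.
have PU n : P n (U n).
  elim: n => [|n IH]; first by split; rewrite expr0 divr1.
  by have [] := FP (n, U n) IH.
have dU n : cabs ((U n.+1).1.1 - (U n).1.1) <= s / 2 ^+ n.
  by have [] := FP (n, U n) (PU n).
have dUU n k : cabs ((U (n + k)%N).1.1 - (U n).1.1)
    <= 2 * (s / 2 ^+ n) - 2 * (s / 2 ^+ (n + k)).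
  elim: k => [|k IH]; first by rewrite addn0 !subrr cabs0.
  rewrite addnS -(subrK (U (n + k)%N).1.1 (U (n + k).+1).1.1) -addrA.
  apply: le_trans (le_cabsD _ _) _.
  have := dU (n + k)%N; move: IH.
  have -> : s / 2 ^+ (n + k)%N = 2 * (s / 2 ^+ (n + k).+1) by rewrite exprS; field.
  lra.
have UK : ((fun n => (U n).1.1) @ \oo) [set z | cabs z <= rho].
  by exists 0%N => // n _ /=; have [_] := PU n; case: (U n) => [[a b] c] [[]].
have [p [/= prho clp]] := compact_disc _ UK.
(* The factor 3 is 2 from the geometric series plus 1 for a later vertex close to the cluster point
   [p]. *)
have pU n : cabs ((U n).1.1 - p) <= 3 * (s / 2 ^+ n).
  have sn : 0 < s / 2 ^+ n by rewrite divr_gt0 ?exprn_gt0.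
  have [||z [[m nm <-] zp]] := clp [set (U m).1.1 | m in [set m | (n <= m)%N]]
      [set z | nrm (z - p) < s / 2 ^+ n].
  - by exists n => // m /= nm; exists m.
  - by apply/nbhs_nrmP; exists (s / 2 ^+ n).
  have := dUU n (m - n)%N; rewrite subnKC// => h1; move: zp => /=; rewrite nrmc => h2.
  have -> : (U n).1.1 - p = - ((U m).1.1 - (U n).1.1) + ((U m).1.1 - p) by ring.
  apply: le_trans (le_cabsD _ _) _; rewrite cabsN.
  have : 0 <= s / 2 ^+ m by rewrite divr_ge0 ?exprn_ge0 ?ltW.
  lra.
have [|d dfp] := hf p; first exact: le_lt_trans prho rr.
(* At level [n], with side bound [sg = s / 2^n], the triangle lies within [4 sg] of [p]. Three sides
   of length at most [sg] and an error [4 eta sg] give [12 eta sg^2], which is [e / 4^n] for this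
   [eta]. *)
have eta0 : 0 < e / (12 * s ^+ 2) by rewrite divr_gt0 ?mulr_gt0 ?exprn_gt0.
have [del del0 hdel] := dfp _ eta0.
have [n nd] : exists n, 4 * (s / 2 ^+ n) < del.
  have : 0 < del / (4 * s) by rewrite divr_gt0 ?mulr_gt0.
  have /cvgrPdist_lt h := @cvg_geometric R 1 (1 / 2) ltac:(by rewrite ger0_norm; lra).
  move=> /h[n _ /(_ n (leqnn _))]; rewrite /= sub0r normrN mul1r.
  rewrite ger0_norm ?exprn_ge0 ?divr_ge0// ltr_pdivlMr ?mulr_gt0// => hn.
  exists n; apply: le_lt_trans hn; rewrite exprVn; lra.
have [bn tn] := PU n.
set sg := s / 2 ^+ n in nd tn.
have sg0 : 0 < sg by rewrite divr_gt0 ?exprn_gt0.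
have [N _] := bn 0; apply/negP; rewrite -leNgt.
have -> : e / 4 ^+ n = 3 * (e / (12 * s ^+ 2) * (4 * sg)) * sg.
  have -> : 4 = 2 ^+ 2 :> R by rewrite -natrX.
  rewrite /sg -exprM mulnC exprM; field.
  by rewrite !expf_neq0// ?gt_eqF.
apply: (@tsum_near_affine _ [set z | cabs (z - p) <= 4 * sg] _ _ rho
  (f p - d * p) d) => //.
- exact: midconvex_disc.
- move=> z /= zp; have := hdel (z - p) (le_lt_trans zp nd).
  rewrite (addrC p) subrK.
  have -> : f z - (f p - d * p + d * z) = f z - f p - d * (z - p) by ring.
  move=> /le_trans; apply; rewrite ler_wpM2l// ltW//.
- by rewrite mulr_ge0 ?ltW// mulr_gt0.
- by rewrite /=; have := pU n; rewrite -/sg; lra.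
- have := pU n; case: (U n) tn => [[a b] c] [_ [/= ab bc ca]]; rewrite -/sg => ap.
  have -> : b - p = (b - a) + (a - p) by ring.
  by apply: le_trans (le_cabsD _ _) _; lra.
- have := pU n; case: (U n) tn => [[a b] c] [_ [/= ab bc ca]]; rewrite -/sg => ap.
  have -> : c - p = - (a - c) + (a - p) by ring.
  by apply: le_trans (le_cabsD _ _) _; rewrite cabsN; lra.
Qed.

End Goursat.

(** * Primitives *)

Section Ucvg.
Context {R : realType} {T : Type} (F : set_system T) {FF : ProperFilter F}.
Local Notation C := R[i].
Implicit Types (u v : T -> C) (l m : C).

Definition ucvg u l := forall e : R, 0 < e -> F [set t | cabs (u t - l) < e].

Lemma ucvgD u v l m : ucvg u l -> ucvg v m -> ucvg (fun t => u t + v t) (l + m).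
Proof.
move=> ul vm e e0; have e2 : 0 < e / 2 by rewrite divr_gt0.
apply: filterS (filterI (ul _ e2) (vm _ e2)) => t [/= h1 h2].
have -> : u t + v t - (l + m) = (u t - l) + (v t - m) by ring.
by apply: le_lt_trans (le_cabsD _ _) _; lra.
Qed.

Lemma ucvgZ a u l : ucvg u l -> ucvg (fun t => a * u t) (a * l).
Proof.
move=> ul e e0; have a0 : 0 < cabs a + 1 by rewrite ltr_wpDl ?cabs_ge0.
apply: filterS (ul _ (divr_gt0 e0 a0)) => t /=.
rewrite -mulrBr cabsM ltr_pdivlMr// => ute.
apply: le_lt_trans ute; rewrite mulrC ler_wpM2l ?cabs_ge0//; lra.
Qed.

Lemma ucvg_cst l : ucvg (fun=> l) l.
Proof.
move=> e e0; apply: filterS (@filterT _ F _) => t _ /=.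
by rewrite subrr cabs0.
Qed.

Lemma ucvgB u v l m : ucvg u l -> ucvg v m -> ucvg (fun t => u t - v t) (l - m).
Proof.
move=> ul vm; have := ucvgD ul (ucvgZ (-1) vm); rewrite mulN1r.
by congr ucvg; apply/funext => t; rewrite mulN1r.
Qed.

Lemma ucvg_le u l M : ucvg u l -> F [set t | cabs (u t) <= M] -> cabs l <= M.
Proof.
move=> ul uM; rewrite leNgt; apply/negP => Ml.
have Ml0 : 0 < cabs l - M by rewrite subr_gt0.
have [t [/= h1 h2]] := filter_ex (filterI (ul _ Ml0) uM).
by have := ler_cabsB l (u t); rewrite cabsBC; lra.
Qed.

Lemma ucvg_unique u l m : ucvg u l -> ucvg u m -> l = m.
Proof.
move=> ul um; apply/eqP; rewrite -subr_eq0 -[_ == _]negbK -cabs_gt0 -leNgt.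
apply: (ucvg_le (ucvgB ul um)); apply: filterS (@filterT _ F _) => t _ /=.
by rewrite subrr cabs0.
Qed.

End Ucvg.

(** The image ultrafilter contains a compact disc, so it converges there. *)
Lemma ultra_ucvg (R : realType) T (F : set_system T) (u : T -> R[i]) (M : R) :
  UltraFilter F -> F [set t | cabs (u t) <= M] -> exists l, ucvg F u l.
Proof.
move=> UF FM; have := @compact_disc R M; rewrite compact_ultra.
move=> /(_ _ (fmap_ultra u UF) FM)[l [_ ul]]; exists l => e e0.
have /ul : nbhs l [set z | cabs (z - l) < e].
  by apply/nbhs_nrmP; exists e => // z; rewrite nrmc.
exact.
Qed.

Section Holo.
Context {R : realType}.
Local Notation C := R[i].
Implicit Types (f g : C -> C) (a b c z w : C).

Definition ccont f z := forall e : R, 0 < e -> exists2 del : R, 0 < del &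
  forall h, cabs h < del -> cabs (f (z + h) - f z) <= e.

Lemma cdiff_cont f z d : cdiff f z d -> ccont f z.
Proof.
move=> fd e e0; have [del del0 hd] := fd 1 ltr01.
have d0 : 0 < cabs d + 1 by rewrite ltr_wpDl ?cabs_ge0.
exists (Order.min del (e / (cabs d + 1))) => [|h]; first by rewrite lt_min del0 divr_gt0.
rewrite lt_min ltr_pdivlMr// => /andP[/hd h1 h2].
have := ler_cabsB (f (z + h) - f z) (d * h); rewrite cabsM; lra.
Qed.

(** Heine-Cantor by the near-covering form of compactness. Half of the radius of continuity at a
    centre is spent on moving the centre, the other half on the increment. *)
Lemma unif_cont f (rho e : R) : (forall z, cabs z <= rho -> ccont f z) -> 0 < e ->
  exists2 del : R, 0 < del & forall z h, cabs z <= rho -> cabs h < del ->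
    cabs (f (z + h) - f z) <= e.
Proof.
move=> fc e0; have := @compact_disc R rho.
move=> /compact_near_coveringP /(_ _ (0 : R)^'+
  (fun del z => forall h, cabs h < del -> cabs (f (z + h) - f z) <= e) _) H.
have [z /fc /(_ (e / 2)) []|del0 /= del00 hdel] := H; first by rewrite divr_gt0.
  move=> del del0 hd.
  exists ([set w | cabs (w - z) < del / 2], [set d | d < del / 2]).
    split => /=; last by apply: nbhs_right_lt; rewrite divr_gt0.
    by apply/nbhs_nrmP; exists (del / 2) => [|w]; rewrite ?divr_gt0 // nrmc.
  move=> [w d] [/= wz dd] h hd'.
  have h1 : cabs (f (z + (w - z + h)) - f z) <= e / 2.
    by apply: hd; apply: le_lt_trans (le_cabsD _ _) _; lra.
  have h2 : cabs (f (z + (w - z)) - f z) <= e / 2 by apply: hd; lra.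
  have -> : f (w + h) - f w =
     (f (z + (w - z + h)) - f z) - (f (z + (w - z)) - f z).
    have -> : z + (w - z + h) = w + h by ring.
    have -> : z + (w - z) = w by ring.
    ring.
  by apply: le_trans (le_cabsD _ _) _; rewrite cabsN; lra.
have del2 : 0 < del0 / 2 by rewrite divr_gt0.
exists (del0 / 2) => // z h zr hh; apply: (hdel (del0 / 2)) => //=.
by rewrite sub0r normrN gtr0_norm //; lra.
Qed.

Lemma disc_bounded f (rho : R) : (forall z, cabs z <= rho -> ccont f z) ->
  exists M : R, forall z, cabs z <= rho -> cabs (f z) <= M.
Proof.
move=> fc; have := @compact_disc R rho.
move=> /compact_near_coveringP /(_ _ (+oo%R : set_system R)
  (fun M z => cabs (f z) <= M) _) H.
have [z /fc /(_ 1 ltr01) [del del0 hd]|M [_ hM]] := H.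
  exists ([set w | cabs (w - z) < del], [set M | cabs (f z) + 1 < M]).
    split => /=; last by apply: nbhs_pinfty_gt; rewrite num_real.
    by apply/nbhs_nrmP; exists del => // w; rewrite nrmc.
  move=> [w M] [/= wz hM]; have := hd _ wz; rewrite (addrC z) subrK.
  by have := ler_cabsB (f w) (f z); lra.
by exists (M + 1) => z zr; apply: (hM (M + 1)) => //; rewrite ltrDl.
Qed.

(* With [v = 0] this gives [F' = f]; with [u + v * w] the linearization of [f] at
   [z], it gives the second order expansion of [F] at [z]. *)
Lemma primitive f (r rho : R) : holo_disc f r -> rho < r ->
  exists F : C -> C, forall z h u v (e : R), cabs z <= rho -> cabs (z + h) <= rho ->
  (forall w, cabs (w - z) <= cabs h -> cabs (f w - (u + v * w)) <= e) ->
  cabs (F (z + h) - F z - (u * h + v * ((z + h) ^+ 2 - z ^+ 2) / 2))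
    <= e * cabs h.
Proof.
move=> hf rr.
have [rho0|rho0] := ltP rho 0.
  exists f => z h u v e z0; have := cabs_ge0 z; lra.
have fc z : cabs z <= rho -> ccont f z.
  by move=> zr; have [|d /cdiff_cont//] := hf z; exact: le_lt_trans zr rr.
have [M fM] := disc_bounded fc.
(* The sums from 0 to [z] are bounded in [n], hence converge along an ultrafilter finer than [\oo];
   the limit serves as [F z]. *)
have [U [UU Uoo]] := ultraFilterLemma eventually_filter.
have /choice[F FP] : forall z, exists l, cabs z <= rho ->
    ucvg U (fun n => isum f n 0 z) l.
  move=> z; have [zr|] := pselect (cabs z <= rho); last by exists 0.
  have [|l ul] := @ultra_ucvg _ _ _ (fun n => isum f n 0 z) (M * rho) UU.
    apply: Uoo; exists 0%N => // n _ /=.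
    have h : cabs (isum f n 0 z) <= M * cabs (z - 0).
      apply: (@isum_bound _ f _ M n 0 z (@midconvex_disc _ 0 rho)) => [w||].
      - by rewrite /mkset subr0; exact: fM.
      - by rewrite /mkset subrr cabs0.
      - by rewrite /mkset subr0.
    apply: le_trans h _; rewrite subr0 ler_wpM2l //.
    by apply: le_trans (fM 0 _); rewrite ?cabs_ge0 ?cabs0.
  by exists l.
exists F => z h u v e zr zhr fe.
set X := u * h + _.
have lim : ucvg U (fun n => isum f n 0 (z + h) - isum f n 0 z - X)
    (F (z + h) - F z - X).
  by apply: ucvgB; [apply: ucvgB; exact: FP|exact: ucvg_cst].
apply: ler_eps => e' e'0; apply: (ucvg_le lim).
(* The triangle [0, z, z + h] replaces the difference of two sums based at 0 by the sum from [z] to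
   [z + h]. The [+ 1] keeps the bound on the sides positive when [rho = 0]. *)
have [||N HN] := @cauchy_goursat _ f r rho (2 * rho + 1) e' (0, z, z + h) hf rr _ _ e'0.
- lra.
- have := le_cabsD (z + h) (- z); rewrite cabsN.
  have -> : z + h - z = h by ring.
  move=> hh; do 2 split => //; rewrite ?cabs0 //.
  + by rewrite subr0; lra.
  + by rewrite (_ : z + h - z = h); [lra|ring].
  + by rewrite sub0r cabsN; lra.
apply: Uoo; exists N => // n Nn /=; have := HN n Nn.
rewrite /= [isum f n (z + h) 0]isum_antisym => h1.
have h2 := @isum_near_affine _ f [set w | cabs (w - z) <= cabs h] e u v n z (z + h)
  (@midconvex_disc _ _ _) fe.
have -> : isum f n 0 (z + h) - isum f n 0 z - X =
  (isum f n z (z + h) - (u * (z + h - z) + v * ((z + h) ^+ 2 - z ^+ 2) / 2))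
  - (isum f n 0 z + isum f n z (z + h) - isum f n 0 (z + h)).
  by rewrite /X; field.
apply: le_trans (le_cabsD _ _) _; rewrite cabsN; apply: lerD h1.
move: h2; have -> : z + h - z = h by ring.
by apply; rewrite /= ?subrr ?cabs0 ?cabs_ge0 //;
  have -> : z + h - z = h by ring.
Qed.

End Holo.

(** * Maximum principle and Schwarz' lemma *)

Section MaxPrinciple.
Context {R : realType}.
Local Notation C := R[i].
Implicit Types (f g : C -> C) (a b c z w : C).

(** The five-point discrete Laplacian of [g] at [z] is [o(d^2)]: a form of harmonicity that
    presupposes no second derivatives. *)
Definition mv4 g z := forall e : R, 0 < e -> exists2 del : R, 0 < del &
  forall d : R, 0 < d < del ->
  cabs (g (z + d%:C%C) + g (z - d%:C%C) + g (z + 'i%C * d%:C%C)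
    + g (z - 'i%C * d%:C%C) - 4 * g z) <= e * d ^+ 2.

Lemma cabs_sqr z : cabs z ^+ 2 = complex.Re z ^+ 2 + complex.Im z ^+ 2.
Proof. by case: z => x y; rewrite sqr_sqrtr// addr_ge0// sqr_ge0. Qed.

Lemma ccont_cvg g z : ccont g z -> {for z, continuous (fun w => cabs (g w))}.
Proof.
move=> gc A /nbhs_ballP[e /= e0 eA].
have e20 : 0 < e / 2 by rewrite divr_gt0.
have [del del0 hd] := gc _ e20.
apply/nbhs_nrmP; exists del => // w; rewrite nrmc => /hd; rewrite (addrC z) subrK => gw.
apply: eA; rewrite /ball /=; move: gw.
have := ler_cabsB (g w) (g z); have := ler_cabsB (g z) (g w).
rewrite (cabsBC (g z)) ltr_norml => h1 h2 h3; apply/andP; split; lra.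
Qed.

(* At an interior maximum of [|g z| + e |z|^2], the average over the four points
   [z + i^j d] would exceed the value at [z] by about [e d^2]. *)
Lemma max_principle_mv4 g (rho B : R) :
  (forall z, cabs z <= rho -> ccont g z) ->
  (forall z, cabs z < rho -> mv4 g z) ->
  (forall z, cabs z = rho -> cabs (g z) <= B) ->
  forall z, cabs z <= rho -> cabs (g z) <= B.
Proof.
move=> gc g4 gB z1 z1r; rewrite leNgt; apply/negP => Bz1.
(* So small that adding [e |z|^2] on the disc costs less than the excess of [|g z1|] over [B]; the
   maximum of [u] is then not on the boundary circle. *)
pose e := (cabs (g z1) - B) / (2 * (rho ^+ 2 + 1)).
have r1 : 0 < 2 * (rho ^+ 2 + 1) by rewrite mulr_gt0// ltr_wpDl// sqr_ge0.
have e0 : 0 < e by rewrite divr_gt0// subr_gt0.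
have eB : B + e * rho ^+ 2 < cabs (g z1).
  have : e * (2 * (rho ^+ 2 + 1)) = cabs (g z1) - B.
    by rewrite /e mulfVK// gt_eqF.
  have := mulr_ge0 (ltW e0) (sqr_ge0 rho); lra.
pose u z : R := cabs (g z) + e * cabs z ^+ 2.
have uc : {within [set z | cabs z <= rho], continuous u}.
  apply: continuous_in_subspaceT => z /set_mem /= zr.
  have gz := ccont_cvg (gc z zr).
  have idz : {for z, continuous (fun w => cabs w)}.
    by apply: (@ccont_cvg id) => d d0; exists d => // h /ltW; rewrite addrC addKr.
  have -> : u = (fun w => cabs (g w)) \+ (cst e \* (cabs \* cabs)).
    by apply/funext => w; rewrite /u /= expr2.
  apply: continuousD => //; apply: continuousM; first exact: cst_continuous.
  exact: continuousM.
have [|z0 /set_mem /= z0r umax] := compact_EVT_max _ (@compact_disc R rho) uc.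
  by exists z1.
have u1 : u z1 <= u z0 by apply: umax; apply/mem_set.
have {}u1 : B + e * rho ^+ 2 < u z0.
  by apply: lt_le_trans u1; rewrite (lt_le_trans eB)// lerDl mulr_ge0 ?sqr_ge0// ltW.
have {}z0r : cabs z0 < rho.
  rewrite lt_neqAle z0r andbT; apply/eqP => z0E; move: u1.
  by rewrite /u z0E; have := gB _ z0E; lra.
have [del del0 hd] := g4 _ z0r _ e0.
pose d := Order.min del (rho - cabs z0) / 2.
have [d0 ddel dr] : [/\ 0 < d, d < del & cabs z0 + d <= rho].
  have m0 : 0 < Order.min del (rho - cabs z0) by rewrite lt_min del0 subr_gt0.
  have : Order.min del (rho - cabs z0) <= del by rewrite ge_min lexx.
  have : Order.min del (rho - cabs z0) <= rho - cabs z0 by rewrite ge_min lexx orbT.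
  by rewrite /d; split; lra.
have {}hd := hd d; rewrite d0 ddel in hd; have {}hd := hd isT.
have dabs : cabs d%:C%C = d by rewrite cabs_real gtr0_norm.
have idabs : cabs ('i%C * d%:C%C) = d by rewrite cabsM cabs_i mul1r.
have um h : cabs h = d -> u (z0 + h) <= u z0.
  move=> hE; apply: umax; apply/mem_set => /=.
  by apply: le_trans (le_cabsD _ _) _; rewrite hE.
have := um _ dabs; have := um _ idabs.
have := um (- d%:C%C); rewrite cabsN => /(_ dabs).
have := um (- ('i%C * d%:C%C)); rewrite cabsN => /(_ idabs).
(* The sum of [e |z|^2] over the four points exceeds four times its value at [z0] by [4 e d^2],
   whereas [mv4] lets the sum of the [|g|] fall short of [4 |g z0|] by at most [e d^2]. This
   contradicts maximality of [u] at [z0]. *)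
have sq : cabs (z0 + d%:C%C) ^+ 2 + cabs (z0 - d%:C%C) ^+ 2 +
  cabs (z0 + 'i%C * d%:C%C) ^+ 2 + cabs (z0 - 'i%C * d%:C%C) ^+ 2 =
  4 * cabs z0 ^+ 2 + 4 * d ^+ 2.
  rewrite !cabs_sqr; case: (z0) => x y; simpc => /=; ring.
move: sq hd; rewrite /u.
set A1 := cabs (z0 + d%:C%C) ^+ 2; set A2 := cabs (z0 - d%:C%C) ^+ 2.
set A3 := cabs (z0 + 'i%C * d%:C%C) ^+ 2; set A4 := cabs (z0 - 'i%C * d%:C%C) ^+ 2.
set G1 := g (z0 + d%:C%C); set G2 := g (z0 - d%:C%C).
set G3 := g (z0 + 'i%C * d%:C%C); set G4 := g (z0 - 'i%C * d%:C%C).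
move=> sq hd h4 h2 h3 h1.
have : 4 * cabs (g z0) <= cabs G1 + cabs G2 + cabs G3 + cabs G4 + e * d ^+ 2.
  rewrite -(cabs_nat 4) -cabsM; apply: le_trans (ler_cabsB _ (G1 + G2 + G3 + G4)) _.
  rewrite (cabsBC (4 * g z0)); apply: lerD => //.
  do 2 (apply: le_trans (le_cabsD _ _) _; rewrite lerD2r).
  exact: le_cabsD.
have : 0 < e * d ^+ 2 by rewrite mulr_gt0// exprn_gt0.
have : e * A1 + e * A2 + e * A3 + e * A4 = 4 * (e * cabs z0 ^+ 2) + 4 * (e * d ^+ 2).
  by rewrite -!mulrDr sq; ring.
lra.
Qed.

(** In the expansion [f z * h + d1 * h^2 / 2] of [F], both terms cancel when summed over
    [h = d, -d, i d, -i d], since [i^2 = -1]. *)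
Lemma primitive_mv4 f F z (rho : R) : cabs z < rho ->
  (exists d, cdiff f z d) ->
  (forall h u v (e : R), cabs (z + h) <= rho ->
    (forall w, cabs (w - z) <= cabs h -> cabs (f w - (u + v * w)) <= e) ->
    cabs (F (z + h) - F z - (u * h + v * ((z + h) ^+ 2 - z ^+ 2) / 2))
      <= e * cabs h) ->
  mv4 F z.
Proof.
move=> zr [d1 fd] hF e e0.
have e4 : 0 < e / 4 by rewrite divr_gt0.
have [del del0 hdel] := fd _ e4.
exists (Order.min del (rho - cabs z)) => [|d /andP[d0]].
  by rewrite lt_min del0 subr_gt0.
rewrite lt_min => /andP[ddel dr].
(* The linearization of [f] is off by at most [e / 4 * d] up to distance [d]; the factor [|h| = d]
   gives a quarter of the permitted error. *)
have est h : cabs h = d ->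
    cabs (F (z + h) - F z - (f z * h + d1 * h ^+ 2 / 2)) <= e / 4 * d ^+ 2.
  move=> hE; have := hF h (f z - d1 * z) d1 (e / 4 * d).
  rewrite hE (_ : e / 4 * d * d = e / 4 * d ^+ 2); last by ring.
  have -> : (f z - d1 * z) * h + d1 * ((z + h) ^+ 2 - z ^+ 2) / 2
    = f z * h + d1 * h ^+ 2 / 2 by field.
  apply; first by apply: le_trans (le_cabsD _ _) _; rewrite hE; lra.
  move=> w wz; have := hdel (w - z) (le_lt_trans wz ddel).
  rewrite (addrC z) subrK.
  have -> : f w - f z - d1 * (w - z) = f w - (f z - d1 * z + d1 * w) by ring.
  by move/le_trans; apply; rewrite ler_pM2l.
have dabs : cabs d%:C%C = d by rewrite cabs_real gtr0_norm.
have idabs : cabs ('i%C * d%:C%C) = d by rewrite cabsM cabs_i mul1r.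
have := est _ dabs; have := est _ idabs.
have := est (- d%:C%C); rewrite cabsN => /(_ dabs).
have := est (- ('i%C * d%:C%C)); rewrite cabsN => /(_ idabs).
have i2 : ('i%C * d%:C%C) ^+ 2 = - d%:C%C ^+ 2 :> C by rewrite exprMn sqr_i mulN1r.
set A := (X in cabs X <= _ -> _); set B := (X in _ -> cabs X <= _ -> _).
set D := (X in _ -> _ -> cabs X <= _ -> _); set E := (X in _ -> _ -> _ -> cabs X <= _ -> _).
move=> hA hB hD hE.
have -> : F (z + d%:C%C) + F (z - d%:C%C) + F (z + 'i%C * d%:C%C) +
   F (z - 'i%C * d%:C%C) - 4 * F z = A + B + D + E.
  by rewrite /A /B /D /E !sqrrN i2; field.
apply: le_trans (le_cabsD _ _) _.
have := le_cabsD (A + B) D; have := le_cabsD A B; lra.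
Qed.

End MaxPrinciple.

Section Schwarz.
Context {R : realType}.
Local Notation C := R[i].
Implicit Types (f g : C -> C) (a b c z w : C).

(** The difference quotient [g] of a primitive is a combination of two translates of [F], so it
    inherits [mv4], and it is uniformly close to [f] on the disc. The closeness [e] is spent twice,
    on the circle and at [z1], whence [e = e' / 2]. *)
Lemma max_principle f (r rho B : R) : holo_disc f r -> 0 < rho < r ->
  (forall z, cabs z = rho -> cabs (f z) <= B) ->
  forall z, cabs z <= rho -> cabs (f z) <= B.
Proof.
move=> hf /andP[rho0 rr] fB z1 z1r.
(* An intermediate radius: the primitive must exist at [z + h] as well as at [z]. *)
pose rho' := (rho + r) / 2.
have [rr' r'r] : rho < rho' /\ rho' < r by rewrite /rho'; split; lra.
have [F hF] := primitive hf r'r.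
have fc z : cabs z < r -> ccont f z by move=> /hf[d /cdiff_cont].
apply: ler_eps => e' e'0; pose e := e' / 2.
have e0 : 0 < e by rewrite divr_gt0.
have [del del0 hdel] := @unif_cont _ f rho e (fun z zr => fc z (le_lt_trans zr rr)) e0.
pose d := Order.min del (rho' - rho) / 2.
have m0 : 0 < Order.min del (rho' - rho) by rewrite lt_min del0 subr_gt0.
have [d0 ddel dr] : [/\ 0 < d, d < del & rho + d < rho'].
  have : Order.min del (rho' - rho) <= del by rewrite ge_min lexx.
  have : Order.min del (rho' - rho) <= rho' - rho by rewrite ge_min lexx orbT.
  by rewrite /d; split; lra.
pose h : C := d%:C%C.
have hE : cabs h = d by rewrite cabs_real gtr0_norm.
have h0 : h != 0 by rewrite -cabs_gt0 hE.
have zh z : cabs z <= rho -> cabs (z + h) < rho'.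
  by move=> zr; apply: le_lt_trans (le_cabsD _ _) _; rewrite hE; lra.
have Fc z : cabs z < rho' -> ccont F z.
  move=> zr; apply: (@cdiff_cont _ _ _ (f z)) => eta eta0.
  have [del1 del10 hd1] := fc z (lt_trans zr r'r) eta eta0.
  exists (Order.min del1 (rho' - cabs z)) => [|k]; first by rewrite lt_min del10 subr_gt0.
  rewrite lt_min => /andP[kd kr].
  have := hF z k (f z) 0 eta; rewrite !mul0r addr0; apply; first exact: ltW.
    by apply: le_trans (le_cabsD _ _) _; lra.
  move=> w wk; rewrite mul0r addr0.
  by have := hd1 _ (le_lt_trans wk kd); rewrite (addrC z) subrK.
pose g z := (F (z + h) - F z) / h.
have gf z : cabs z <= rho -> cabs (g z - f z) <= e.
  move=> zr; have := hF z h (f z) 0 e; rewrite !mul0r addr0.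
  have -> : F (z + h) - F z - f z * h = (g z - f z) * h.
    by rewrite /g; field; exact: h0.
  rewrite cabsM ler_pM2r ?hE//; apply; [lra|exact/ltW/zh|].
  move=> w wz; rewrite mul0r addr0.
  have := hdel z (w - z) zr (le_lt_trans wz ddel).
  by rewrite (addrC z) subrK.
have hF' z : cabs z < rho' -> mv4 F z.
  move=> zr; apply: (@primitive_mv4 _ f F z rho') => //.
    exact: hf (lt_trans zr r'r).
  by move=> k u v eta kr; apply: hF => //; exact: ltW.
have gc z : cabs z <= rho -> ccont g z.
  move=> zr eta eta0.
  have eta1 : 0 < eta * d / 2 by rewrite !mulr_gt0// invr_gt0.
  have [del1 del10 hd1] := Fc z (le_lt_trans zr rr') _ eta1.
  have [del2 del20 hd2] := Fc _ (zh z zr) _ eta1.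
  exists (Order.min del1 del2) => [|k]; first by rewrite lt_min del10.
  rewrite lt_min => /andP[/hd1 k1 /hd2 k2].
  rewrite /g -mulrBl cabsM cabsV hE ler_pdivrMr//.
  have -> : F (z + k + h) - F (z + k) - (F (z + h) - F z) =
    (F (z + h + k) - F (z + h)) - (F (z + k) - F z) by rewrite (addrAC z); ring.
  by apply: le_trans (le_cabsD _ _) _; rewrite cabsN; lra.
have g4 z : cabs z < rho -> mv4 g z.
  move=> zr eta eta0.
  have eta1 : 0 < eta * d / 2 by rewrite !mulr_gt0// invr_gt0.
  have [del1 del10 hd1] := hF' z (lt_trans zr rr') _ eta1.
  have [del2 del20 hd2] := hF' _ (zh z (ltW zr)) _ eta1.
  exists (Order.min del1 del2) => [|k]; first by rewrite lt_min del10.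
  rewrite lt_min => /and3P[k0 kd1 kd2].
  have {hd1} := hd1 k; rewrite k0 kd1 => /(_ isT).
  have {hd2} := hd2 k; rewrite k0 kd2 => /(_ isT).
  set X := (X in cabs X <= _ -> _); set Y := (X in _ -> cabs X <= _ -> _) => hX hY.
  rewrite (_ : g _ + _ + _ + _ - _ = (X - Y) / h); last first.
    by rewrite /g /X /Y !(addrAC z _ h); field; exact: h0.
  rewrite cabsM cabsV hE ler_pdivrMr//.
  by apply: le_trans (le_cabsD _ _) _; rewrite cabsN; lra.
have gB z : cabs z = rho -> cabs (g z) <= B + e.
  move=> zr; have := gf z; rewrite zr lexx => /(_ isT).
  by have := ler_cabsB (g z) (f z); have := fB z zr; lra.
have := max_principle_mv4 gc g4 gB z1r; have := gf z1 z1r.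
by rewrite cabsBC; have := ler_cabsB (f z1) (g z1); rewrite /e; lra.
Qed.

Lemma cdiff_cst a z : cdiff (fun=> a) z 0.
Proof.
move=> e e0; exists 1 => // h _.
by rewrite subrr mul0r subrr cabs0 mulr_ge0 ?cabs_ge0// ltW.
Qed.

Lemma cdiffM f g z a b : cdiff f z a -> cdiff g z b ->
  cdiff (fun w => f w * g w) z (a * g z + f z * b).
Proof.
move=> fa gb e e0.
have pos c : 0 < cabs c + 1 by rewrite ltr_wpDl ?cabs_ge0.
have epos c : 0 < e / (3 * (cabs c + 1)) by rewrite divr_gt0// mulr_gt0.
have [d1 d10 h1] := fa _ (epos (g z)).
have [d2 d20 h2] := gb _ (epos (f z)).
have [d3 d30 h3] := cdiff_cont gb (epos a).
have [d4 d40 h4] := cdiff_cont gb ltr01.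
exists (Order.min (Order.min d1 d2) (Order.min d3 d4)) => [|h].
  by rewrite !lt_min d10 d20 d30.
rewrite !lt_min => /andP[/andP[/h1 {}h1 /h2 {}h2] /andP[/h3 {}h3 /h4 {}h4]].
have -> : f (z + h) * g (z + h) - f z * g z - (a * g z + f z * b) * h =
  (f (z + h) - f z - a * h) * g (z + h) + a * h * (g (z + h) - g z)
  + f z * (g (z + h) - g z - b * h) by ring.
have gh : cabs (g (z + h)) <= cabs (g z) + 1.
  by have := ler_cabsB (g (z + h)) (g z); lra.
have bnd (x y : R) c : 0 <= x -> x <= cabs c + 1 ->
    y <= e / (3 * (cabs c + 1)) * cabs h -> 0 <= y ->
    y * x <= e / 3 * cabs h.
  move=> x0 xc yc y0; apply: le_trans (ler_wpM2l y0 xc) _.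
  apply: le_trans (ler_wpM2r (ltW (pos c)) yc) _.
  by apply: ler_refl_eq; field; rewrite gt_eqF.
have q1 := bnd _ _ _ (cabs_ge0 _) gh h1 (cabs_ge0 _).
have q2 : cabs a * (cabs (g (z + h) - g z) * cabs h) <= e / 3 * cabs h.
  rewrite mulrC; apply: (bnd _ _ a) => //; rewrite ?cabs_ge0 ?lerDl//.
    by rewrite ler_wpM2r ?cabs_ge0.
  by rewrite mulr_ge0 ?cabs_ge0.
have q3 : cabs (f z) * cabs (g (z + h) - g z - b * h) <= e / 3 * cabs h.
  by rewrite mulrC; apply: (bnd _ _ (f z)) => //; rewrite ?cabs_ge0 ?lerDl.
apply: le_trans (le_cabsD _ _) _.
have := le_cabsD ((f (z + h) - f z - a * h) * g (z + h)) (a * h * (g (z + h) - g z)).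
rewrite !cabsM; lra.
Qed.

Lemma cdiffX f z a n : cdiff f z a -> exists b, cdiff (fun w => f w ^+ n) z b.
Proof.
move=> fa; elim: n => [|n [b fb]].
  by exists 0; exact: cdiff_cst.
exists (a * f z ^+ n + f z * b).
rewrite (_ : (fun w => f w ^+ n.+1) = (fun w => f w * f w ^+ n)); first exact: cdiffM.
by apply/funext => w; rewrite exprS.
Qed.

Lemma cdiffB_cst f z a b : cdiff f z a -> cdiff (fun w => f w - b) z a.
Proof.
move=> fa e /fa[d d0 h]; exists d => // k /h.
by rewrite (_ : f (z + k) - b - (f z - b) = f (z + k) - f z); last ring.
Qed.

Lemma cdiffV z : z != 0 -> cdiff (fun w => w^-1) z (- (z ^+ 2)^-1).
Proof.
move=> z0 e e0; have az : 0 < cabs z by rewrite cabs_gt0.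
have e1 : 0 < e * cabs z ^+ 3 / 2 by rewrite !mulr_gt0 ?invr_gt0// exprn_gt0.
exists (Order.min (cabs z / 2) (e * cabs z ^+ 3 / 2)) => [|h].
  by rewrite lt_min e1 divr_gt0.
rewrite lt_min => /andP[h1 h2].
have zh : cabs z / 2 < cabs (z + h).
  by have := ler_cabsB z (z + h); rewrite cabsBC (_ : z + h - z = h); [lra|ring].
have zh0 : z + h != 0 by rewrite -cabs_gt0; apply: lt_trans zh; rewrite divr_gt0.
have -> : (z + h)^-1 - z^-1 - - (z ^+ 2)^-1 * h = h / (z ^+ 2 * (z + h)) * h.
  by field; rewrite zh0.
rewrite cabsM ler_wpM2r ?cabs_ge0// cabsM cabsV cabsM cabsX.
rewrite ler_pdivrMr; last by rewrite mulr_gt0 ?exprn_gt0// (lt_trans _ zh)// divr_gt0.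
apply: le_trans (ltW h2) _.
have -> : e * cabs z ^+ 3 / 2 = e * (cabs z ^+ 2 * (cabs z / 2)) by ring.
by rewrite ler_pM2l// ler_pM2l ?exprn_gt0//; exact: ltW.
Qed.

(** For [schwarz]: there it controls powers of the difference quotient of [f] at the origin. *)
Lemma exprB_bound a b (d : R) n : cabs (a - b) <= d -> d <= 1 ->
  cabs (a ^+ n - b ^+ n) <= n%:R * (cabs b + 1) ^+ n * d.
Proof.
move=> abd d1; have d0 : 0 <= d := le_trans (cabs_ge0 _) abd.
have b0 := cabs_ge0 b.
have A1 : 1 <= cabs b + 1 by lra.
have aA : cabs a <= cabs b + 1 by have := ler_cabsB a b; lra.
elim: n => [|n IH]; first by rewrite !expr0 subrr cabs0 !mul0r.
have -> : a ^+ n.+1 - b ^+ n.+1 = (a ^+ n - b ^+ n) * a + b ^+ n * (a - b).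
  by rewrite !exprSr; ring.
apply: le_trans (le_cabsD _ _) _; rewrite !cabsM cabsX.
have q1 : cabs (a ^+ n - b ^+ n) * cabs a
    <= n%:R * (cabs b + 1) ^+ n * d * (cabs b + 1) by rewrite ler_pM ?cabs_ge0.
have q2 : cabs b ^+ n * cabs (a - b) <= (cabs b + 1) ^+ n.+1 * d.
  rewrite ler_pM ?exprn_ge0 ?cabs_ge0//.
  apply: (@le_trans _ _ ((cabs b + 1) ^+ n)).
    by apply: lerXn2r; rewrite ?nnegrE//; lra.
  by rewrite ler_weXn2l.
apply: le_trans (lerD q1 q2) _; rewrite -natr1 exprSr.
by apply: ler_refl_eq; ring.
Qed.

(** In the constant, [2 B] bounds [|f - f 0|] and [r / 2] is the radius of the circle to which the
    maximum principle is applied. *)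
Lemma schwarz f (r B : R) : holo_disc f r -> (forall t, cabs t < r -> cabs (f t) <= B) ->
  forall t, cabs t < r -> cabs (f t - f 0) <= 4 * B / r * cabs t.
Proof.
move=> hf fB t tr.
have r0 : 0 < r := le_lt_trans (cabs_ge0 t) tr.
have B0 : 0 <= B by apply: le_trans (cabs_ge0 (f 0)) (fB 0 _); rewrite cabs0.
have fB2 w : cabs w < r -> cabs (f w - f 0) <= 2 * B.
  move=> wr; apply: le_trans (le_cabsD _ _) _; rewrite cabsN.
  by have := fB w wr; have := fB 0; rewrite cabs0 => /(_ r0); lra.
(* From radius [r / 2] on, the trivial bound [2 B] is already good enough. *)
have [rt|tr2] := leP (r / 2) (cabs t).
  apply: le_trans (fB2 _ tr) _; rewrite mulrAC ler_pdivlMr//.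
  by have := ler_wpM2l B0 rt; lra.
set x := cabs (f t - f 0).
rewrite leNgt; apply/negP; set a := (X in X < x) => ax.
have a0 : 0 <= a by rewrite !mulr_ge0 ?cabs_ge0 ?invr_ge0// ltW.
have x0 : 0 < x := le_lt_trans a0 ax.
have key n : x ^+ n.+1 <= a ^+ n * (2 * B).
  (* The convention [0^-1 = 0] is harmless: the first factor vanishes at 0, so [G 0 = 0] for every
     [n]. *)
  pose G w := (f w - f 0) ^+ n.+1 * (w^-1) ^+ n.
  have [|d0 fd0] := hf 0; first by rewrite cabs0.
  have hG : holo_disc G r.
    move=> w wr; have [d fd] := hf w wr; have [->|w0] := eqVneq w 0; last first.
      have [b1 gb1] := cdiffX n.+1 (cdiffB_cst (f 0) fd).
      have [b2 gb2] := cdiffX n (cdiffV w0).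
      by eexists; exact: (cdiffM gb1 gb2).
    (* Off 0, [G h] equals [h] times the power [n.+1] of the difference quotient of [f], and that
       power tends to this value. *)
    exists (d0 ^+ n.+1) => e e0.
    pose K := n.+1%:R * (cabs d0 + 1) ^+ n.+1 : R.
    have K0 : 0 < K by rewrite mulr_gt0 ?ltr0n// exprn_gt0// ltr_wpDl ?cabs_ge0.
    have m0 : 0 < Order.min 1 (e / K) by rewrite lt_min ltr01 divr_gt0.
    have [del del0 hdel] := fd0 _ m0; exists del => // h /hdel.
    rewrite add0r /G subrr expr0n !mul0r subr0.
    have [->|h0] := eqVneq h 0.
      by move=> _; rewrite subrr expr0n !mul0r mulr0 subr0 cabs0 mulr0.
    have ah : 0 < cabs h by rewrite cabs_gt0.
    have -> : f h - f 0 - d0 * h = ((f h - f 0) / h - d0) * h.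
      by field; exact: h0.
    rewrite cabsM ler_pM2r// => qd.
    have -> : (f h - f 0) ^+ n.+1 * h^-1 ^+ n - d0 ^+ n.+1 * h =
        (((f h - f 0) / h) ^+ n.+1 - d0 ^+ n.+1) * h.
      rewrite exprMn mulrBl; congr (_ - _).
      by rewrite [h^-1 ^+ n.+1]exprSr -!mulrA mulVf// mulr1.
    rewrite cabsM ler_pM2r//; apply: le_trans (exprB_bound n.+1 qd _) _.
      by rewrite ge_min lexx.
    rewrite mulrC -/K -ler_pdivlMr// ge_min lexx orbT //.
  have r2 : 0 < r / 2 < r by apply/andP; split; lra.
  have GB w : cabs w = r / 2 -> cabs (G w) <= (2 * B) ^+ n.+1 * (r / 2)^-1 ^+ n.
    move=> wr; rewrite /G cabsM !cabsX cabsV wr ler_wpM2r ?exprn_ge0 ?invr_ge0//.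
      lra.
    apply: lerXn2r; rewrite ?nnegrE ?cabs_ge0 ?mulr_ge0//.
    by apply: fB2; rewrite wr; lra.
  have [t0|t0] := eqVneq t 0.
    by move: x0; rewrite /x t0 subrr cabs0 ltxx.
  have at0 : 0 < cabs t by rewrite cabs_gt0.
  have := max_principle hG r2 GB (ltW tr2); rewrite /G cabsM !cabsX cabsV.
  rewrite !exprVn ler_pdivrMr ?exprn_gt0// => /le_trans; apply.
  have -> : a = 2 * B / (r / 2) * cabs t by rewrite /a; field; rewrite gt_eqF.
  move: (2 * B) (r / 2) => b q.
  by apply: ler_refl_eq; rewrite exprSr exprMn expr_div_n; ring.
have q1 : a / x < 1 by rewrite ltr_pdivrMr// mul1r.
have q0 : 0 <= a / x by rewrite divr_ge0// ltW.
have B1 : 0 < 2 * B + 1 by lra.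
(* As [a < x], some [n] has [a^n (2 B + 1) < x^(n+1)], against [key]. *)
have /cvgrPdist_lt hc := @cvg_geometric R 1 (a / x) ltac:(by rewrite ger0_norm).
have [n _ /(_ n (leqnn _))] := hc (x / (2 * B + 1)) (divr_gt0 x0 B1).
rewrite /= sub0r normrN mul1r ger0_norm ?exprn_ge0// expr_div_n.
rewrite ltr_pdivlMr// mulrAC ltr_pdivrMr ?exprn_gt0// -exprS => hn.
by have := key n; have := exprn_ge0 n a0; lra.
Qed.

End Schwarz.

(** * Several variables *)

Section Frechet.
Context {R : realType} {V : normedModType R[i]}.
Local Notation C := R[i].
Implicit Types (f : V -> C) (p q h : V).

Definition ediff f p (L : V -> C) := forall e : R, 0 < e ->
  exists2 del : R, 0 < del & forall h, nrm h < del ->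
    cabs (f (p + h) - f p - L h) <= e * nrm h.

Lemma differentiable_ediff f p : differentiable f p -> ediff f p ('d f p).
Proof.
move=> /diff_locallyP[_ /eqaddoP fp] e e0.
have [|del del0 hd] := (nbhs_nrmP _ _).1 (fp e%:C%C _); first by rewrite ltcR.
exists del => // h hdel; have := hd h; rewrite subr0 => /(_ hdel).
rewrite !normE -rmorphM lecR /= nrmc.
rewrite -[X in cabs X <= _ -> _]/(f (h + p) - (f p + 'd f p h)) (addrC h p).
by rewrite opprD addrA.
Qed.

(** The bound [K] supplies the continuity of the differential, which is part of [differentiable]. *)
Lemma ediff_differentiable f p (L : {linear V -> C}) (K : R) :
  (forall h, cabs (L h) <= K * nrm h) -> ediff f p L -> differentiable f p.
Proof.
move=> LK fL.
have Lc : continuous L.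
  move=> q A /nbhs_nrmP[e e0 eA]; apply/nbhs_nrmP.
  have K1 : 0 < `|K| + 1 by rewrite ltr_wpDl.
  exists (e / (`|K| + 1)) => [|z]; first by rewrite divr_gt0.
  rewrite ltr_pdivlMr// => zq; apply: eA; rewrite nrmc -linearB.
  apply: le_lt_trans (LK _) _; apply: le_lt_trans zq; rewrite mulrC.
  by rewrite ler_wpM2l ?nrm_ge0//; have := ler_norm K; lra.
have fo : f \o shift p = cst (f p) + L +o_ 0 id.
  apply/eqaddoP => e e0.
  have er : e = (complex.Re e)%:C%C by rewrite RRe_real// gtr0_real.
  have [|del del0 hd] := fL (complex.Re e); first by rewrite -ltcR -er.
  apply/nbhs_nrmP; exists del => // h; rewrite subr0 => /hd.
  rewrite !normE er -rmorphM lecR /= nrmc.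
  rewrite -[X in _ -> cabs X <= _]/(f (h + p) - (f p + L h)) (addrC h p).
  by rewrite opprD addrA.
have dL := diff_unique Lc fo.
by apply/diff_locallyP; rewrite dL.
Qed.

Lemma scalar_map0 (L : V -> C) : scalar L -> L 0 = 0.
Proof.
move=> /(_ 1 0 0)/eqP; rewrite scaler0 addr0 mul1r.
by rewrite -subr_eq0 opprD addrA subrr sub0r oppr_eq0 => /eqP.
Qed.

(** The derivative is just a linear map here; for bounded [f] its boundedness follows in
    [holo_deriv_bound]. *)
Definition holo_ball f p (r : R) := forall q, nrm (q - p) < r ->
  exists L : {linear V -> C}, ediff f q L.

(** Schwarz' lemma for [t -> f (p + t h)] on the disc of radius [r / |h|], evaluated at [t = 1]. *)
Lemma holo_lipschitz f p (r B : R) h : holo_ball f p r ->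
  (forall q, nrm (q - p) < r -> cabs (f q) <= B) ->
  nrm h < r -> cabs (f (p + h) - f p) <= 4 * B / r * nrm h.
Proof.
move=> hf fB hr; have [->|h0] := eqVneq h 0.
  by rewrite addr0 subrr cabs0 nrm0 mulr0.
have nh : 0 < nrm h by rewrite nrm_gt0.
have ps t : cabs t < r / nrm h -> nrm (p + t *: h - p) < r.
  by rewrite ltr_pdivlMr// addrC addKr nrmZ.
have hg : holo_disc (fun t => f (p + t *: h)) (r / nrm h).
  move=> t /ps tr; have [L fL] := hf _ tr; exists (L h) => e e0.
  have [del del0 hd] := fL _ (divr_gt0 e0 nh).
  exists (del / nrm h) => [|k]; first by rewrite divr_gt0.
  rewrite ltr_pdivlMr// -nrmZ => /hd.
  rewrite linearZ_LR [_ *: L h]mulrC scalerDl addrA nrmZ => /le_trans; apply.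
  by apply: ler_refl_eq; field; rewrite gt_eqF.
have := schwarz hg (fun t tr => fB _ (ps t tr)) (t := 1).
rewrite cabs1 ltr_pdivlMr// mul1r => /(_ hr).
rewrite scale1r scale0r addr0 mulr1 => /le_trans; apply; apply: ler_refl_eq.
have r0 : r != 0 by rewrite gt_eqF// (lt_trans nh).
by field; rewrite r0 gt_eqF.
Qed.

Lemma holo_diff f p (r : R) h : holo_ball f p (2 * r) -> nrm h < r ->
  holo_ball (fun q => f (q + h) - f q) p r.
Proof.
move=> hf hr q qr.
have [L1 h1] : exists L : {linear V -> C}, ediff f (q + h) L.
  apply: hf; rewrite addrAC; apply: le_lt_trans (nrmD _ _) _; lra.
have [L2 h2] : exists L : {linear V -> C}, ediff f q L.
  by apply: hf; have := nrm_ge0 (q - p); lra.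
exists (L1 \- L2) => e e0; have e2 : 0 < e / 2 by rewrite divr_gt0.
have [d1 d10 {}h1] := h1 _ e2; have [d2 d20 {}h2] := h2 _ e2.
exists (Order.min d1 d2) => [|k]; first by rewrite lt_min d10.
rewrite lt_min => /andP[/h1 {}h1 /h2 {}h2].
have -> : f (q + k + h) - f (q + k) - (f (q + h) - f q) - (L1 \- L2) k =
  (f (q + h + k) - f (q + h) - L1 k) - (f (q + k) - f q - L2 k).
  by rewrite (addrAC q k) /=; ring.
by apply: le_trans (le_cabsD _ _) _; rewrite cabsN; lra.
Qed.

(** [holo_lipschitz] is used twice: for [f] it bounds the increment [f (q + h) - f q], which is then
    the function to which it is applied. Hence the constant [4 * 4] and the radius [2 r]. *)
Lemma holo_second_difference f p (r B : R) h : holo_ball f p (2 * r) ->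
  (forall q, nrm (q - p) < 2 * r -> cabs (f q) <= B) -> nrm h < r ->
  cabs (f (p + h + h) - f (p + h) - (f (p + h) - f p))
    <= 16 * B / r ^+ 2 * nrm h ^+ 2.
Proof.
move=> hf fB hr.
have r0 : 0 < r := le_lt_trans (nrm_ge0 h) hr.
have dB q : nrm (q - p) < r -> cabs (f (q + h) - f q) <= 4 * B / r * nrm h.
  have sub x : nrm (q - p) < r -> nrm (x - q) < r -> nrm (x - p) < 2 * r.
    move=> qr xr; have -> : x - p = (x - q) + (q - p) by rewrite addrA subrK.
    by apply: le_lt_trans (nrmD _ _) _; lra.
  move=> qr; apply: holo_lipschitz hr => x xr; [apply: hf|apply: fB]; exact: sub.
apply: le_trans (holo_lipschitz (holo_diff hf hr) dB hr) _.
by apply: ler_refl_eq; field; rewrite gt_eqF.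
Qed.

(* With [T k = f (p + k) - f p], telescopes [2^n T (h / 2^n)], whose limit is
   [L h], using the bound on second differences. *)
Lemma holo_taylor f p (r B : R) L h : holo_ball f p (2 * r) ->
  (forall q, nrm (q - p) < 2 * r -> cabs (f q) <= B) -> nrm h < r ->
  scalar L -> ediff f p L ->
  cabs (f (p + h) - f p - L h) <= 8 * B / r ^+ 2 * nrm h ^+ 2.
Proof.
move=> hf fB hr linL fL.
have r0 : 0 < r := le_lt_trans (nrm_ge0 h) hr.
have LZ a k : L (a *: k) = a * L k.
  by have := linL a k 0; rewrite (scalar_map0 linL) !addr0.
pose T k := f (p + k) - f p.
pose K := 4 * B / r ^+ 2.
(* A second difference with step [k / 2], whence the constant 16 divided by 4. *)
have Th k : nrm k < r -> cabs (T k - 2 * T (2^-1 *: k)) <= K * nrm k ^+ 2.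
  move=> kr.
  have nk : nrm (2^-1 *: k) = nrm k / 2 by rewrite nrmZ cabsV cabs_nat mulrC.
  have := @holo_second_difference f p r B (2^-1 *: k) hf fB.
  have -> : p + 2^-1 *: k + 2^-1 *: k = p + k.
    by rewrite -addrA -scalerDl (_ : 2^-1 + 2^-1 = 1) ?scale1r//; field.
  rewrite nk => hT.
  have -> : T k - 2 * T (2^-1 *: k) = f (p + k) - f (p + 2^-1 *: k) -
    (f (p + 2^-1 *: k) - f p) by rewrite /T; ring.
  apply: le_trans (hT _) _; first by have := nrm_ge0 k; lra.
  by apply: ler_refl_eq; rewrite /K; field; rewrite gt_eqF.
(* The step from [n] to [n.+1] costs [2^n K |h / 2^n|^2 = K |h|^2 / 2^n], so the total stays below
   [2 K |h|^2]. *)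
have Tn n : cabs (T h - 2 ^+ n * T ((2 ^+ n)^-1 *: h))
    <= 2 * K * nrm h ^+ 2 * (1 - (2 ^+ n)^-1).
  elim: n => [|n IH]; first by rewrite !expr0 !invr1 scale1r mul1r !subrr mulr0 cabs0.
  have nn : nrm ((2 ^+ n)^-1 *: h) = (2 ^+ n)^-1 * nrm h.
    by rewrite nrmZ cabsV cabsX cabs_nat.
  have n0 : 0 < 2 ^+ n :> R by rewrite exprn_gt0.
  have n1 : (2 ^+ n)^-1 <= 1 :> R by rewrite invf_le1// exprn_ege1// ler1n.
  have := Th ((2 ^+ n)^-1 *: h); rewrite nn scalerA -invfM -exprS => hT.
  have {}hT : cabs (2 ^+ n * (T ((2 ^+ n)^-1 *: h) - 2 * T ((2 ^+ n.+1)^-1 *: h)))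
      <= K * nrm h ^+ 2 * (2 ^+ n)^-1.
    rewrite cabsM cabsX cabs_nat mulrC -ler_pdivlMr//; apply: le_trans (hT _) _.
      by apply: le_lt_trans hr; rewrite ler_piMl ?nrm_ge0.
    by apply: ler_refl_eq; field; rewrite gt_eqF.
  have -> : T h - 2 ^+ n.+1 * T ((2 ^+ n.+1)^-1 *: h) =
    (T h - 2 ^+ n * T ((2 ^+ n)^-1 *: h)) +
     2 ^+ n * (T ((2 ^+ n)^-1 *: h) - 2 * T ((2 ^+ n.+1)^-1 *: h)).
    by move: (T ((2 ^+ n.+1)^-1 *: h)) => X; rewrite (exprS 2 n); ring.
  apply: le_trans (le_cabsD _ _) _; apply: le_trans (lerD IH hT) _.
  by apply: ler_refl_eq; rewrite (exprS 2 n); field; rewrite gt_eqF.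
have B0 : 0 <= B.
  by apply: le_trans (cabs_ge0 _) (fB p _); rewrite subrr nrm0 mulr_gt0.
have K0 : 0 <= K by apply: divr_ge0; [exact: mulr_ge0|exact: sqr_ge0].
apply: ler_eps => e e0.
have h1 : 0 < nrm h + 1 by rewrite ltr_wpDl ?nrm_ge0.
have [del del0 hd] := fL _ (divr_gt0 e0 h1).
have [n hn] : exists n, (2 ^+ n)^-1 * nrm h < del.
  have /cvgrPdist_lt hc := @cvg_geometric R 1 2^-1 ltac:(by rewrite ger0_norm; lra).
  have [n _ /(_ n (leqnn _))] := hc _ (divr_gt0 del0 h1).
  rewrite /= sub0r normrN mul1r ger0_norm ?exprn_ge0 ?invr_ge0// ltr_pdivlMr// exprVn => hn.
  exists n; apply: le_lt_trans hn; rewrite ler_wpM2l ?invr_ge0 ?exprn_ge0//; lra.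
have n0 : 0 < 2 ^+ n :> R by rewrite exprn_gt0.
have c0 : 2 ^+ n != 0 :> C by rewrite expf_neq0.
have nn : nrm ((2 ^+ n)^-1 *: h) = (2 ^+ n)^-1 * nrm h.
  by rewrite nrmZ cabsV cabsX cabs_nat.
have := hd ((2 ^+ n)^-1 *: h); rewrite nn LZ => /(_ hn) hL.
have {}hL : cabs (2 ^+ n * T ((2 ^+ n)^-1 *: h) - L h) <= e.
  have -> : 2 ^+ n * T ((2 ^+ n)^-1 *: h) - L h = 2 ^+ n *
     (f (p + (2 ^+ n)^-1 *: h) - f p - (2 ^+ n)^-1 * L h).
    by rewrite /T; field.
  rewrite cabsM cabsX cabs_nat mulrC -ler_pdivlMr//; apply: le_trans hL _.
  rewrite mulrCA mulrC ler_wpM2r ?invr_ge0 ?(ltW n0)//.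
  by rewrite mulrAC ler_pdivrMr// ler_pM2l//; lra.
have -> : f (p + h) - f p - L h = (T h - 2 ^+ n * T ((2 ^+ n)^-1 *: h))
   + (2 ^+ n * T ((2 ^+ n)^-1 *: h) - L h) by rewrite /T; ring.
apply: le_trans (le_cabsD _ _) _; apply: lerD => //; apply: le_trans (Tn n) _.
have -> : 8 * B / r ^+ 2 * nrm h ^+ 2 = 2 * K * nrm h ^+ 2 * 1.
  by rewrite /K; field; rewrite gt_eqF.
apply: ler_wpM2l; first by apply: mulr_ge0; [exact: mulr_ge0|exact: sqr_ge0].
by rewrite gerBl invr_ge0 ltW.
Qed.

(** [L] is compared with the increment of [f] at the multiple of [h] of norm [r / 2], where the
    Taylor error and the increment are each at most [2 B]; homogeneity does the rest. *)
Lemma holo_deriv_bound f p (r B : R) L h : 0 < r -> holo_ball f p (2 * r) ->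
  (forall q, nrm (q - p) < 2 * r -> cabs (f q) <= B) ->
  scalar L -> ediff f p L -> cabs (L h) <= 12 * B / r * nrm h.
Proof.
move=> r0 hf fB linL fL.
have L0 := scalar_map0 linL.
have LZ a k : L (a *: k) = a * L k by have := linL a k 0; rewrite L0 !addr0.
have [->|h0] := eqVneq h 0; first by rewrite L0 nrm0 cabs0 mulr0.
have nh : 0 < nrm h by rewrite nrm_gt0.
have B0 : 0 <= B.
  by apply: le_trans (cabs_ge0 _) (fB p _); rewrite subrr nrm0 mulr_gt0.
pose c := r / 2 / nrm h; have c0 : 0 < c by rewrite !divr_gt0.
have ca : cabs c%:C%C = c by rewrite cabs_real gtr0_norm.
have nk : nrm (c%:C%C *: h) = r / 2 by rewrite nrmZ ca /c mulfVK ?gt_eqF.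
have kr : nrm (c%:C%C *: h) < r by rewrite nk; lra.
have q1 := holo_taylor hf fB kr linL fL.
have q2 : cabs (f (p + c%:C%C *: h) - f p) <= 4 * B / r * nrm (c%:C%C *: h).
  apply: holo_lipschitz kr => q qr; [apply: hf|apply: fB]; lra.
have : cabs (L (c%:C%C *: h)) <= 6 * B.
  have := ler_cabsB (L (c%:C%C *: h)) (f (p + c%:C%C *: h) - f p).
  rewrite (cabsBC (L _)); move: q1 q2; rewrite nk.
  have -> : 8 * B / r ^+ 2 * (r / 2) ^+ 2 = 2 * B by field; rewrite gt_eqF.
  have -> : 4 * B / r * (r / 2) = 2 * B by field; rewrite gt_eqF.
  lra.
rewrite LZ cabsM ca -ler_pdivlMl// => /le_trans; apply; apply: ler_refl_eq.
by rewrite /c; field; rewrite !gt_eqF.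
Qed.

(** The derivatives at [p] are uniformly bounded, so they have a pointwise limit along [F], again
    linear and bounded. The Taylor estimate has constants independent of the function, so it passes
    to the limit and makes this map the derivative of [f]. *)
Lemma ucvg_differentiable (X : Type) (F : set_system X) (u : X -> V -> C) f p
    (r B : R) : UltraFilter F -> 0 < r ->
  F [set x | holo_ball (u x) p (2 * r) /\
             forall q, nrm (q - p) < 2 * r -> cabs (u x q) <= B] ->
  (forall q, nrm (q - p) < 2 * r -> ucvg F (u ^~ q) (f q)) ->
  differentiable f p.
Proof.
move=> UF r0 FS uf.
have p2 : nrm (p - p) < 2 * r by rewrite subrr nrm0 mulr_gt0.
set S := (X in F X) in FS.
have /choice[L LP] : forall x, exists L : {linear V -> C}, S x -> ediff (u x) p L.
  move=> x; have [[hu _]|] := pselect (S x); last by exists (\0).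
  by have [L] := hu p p2; exists L.
have Lb x h : S x -> cabs (L x h) <= 12 * B / r * nrm h.
  move=> Sx; have [hu uB] := Sx.
  by apply: (holo_deriv_bound h r0 hu uB) (LP x Sx); exact: linearP.
have /choice[l lP] : forall h, exists l, ucvg F (fun x => L x h) l.
  move=> h; apply: (ultra_ucvg UF (M := 12 * B / r * nrm h)).
  by apply: filterS FS => x; exact: Lb.
have linl : scalar l.
  move=> a h k; apply: (ucvg_unique (lP _)).
  have : ucvg F (fun x => a * L x h + L x k) (a * l h + l k).
    by apply: ucvgD => //; exact: ucvgZ.
  by congr ucvg; apply/funext => x; rewrite linearP.
pose l' := HB.pack_for {linear V -> C} l (GRing.isLinear.Build _ _ _ _ l linl).
apply: (@ediff_differentiable f p l' (12 * B / r)).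
  by move=> h; apply: (ucvg_le (lP h)); apply: filterS FS => x; exact: Lb.
have est h : nrm h < r ->
    cabs (f (p + h) - f p - l h) <= 8 * B / r ^+ 2 * nrm h ^+ 2.
  move=> hr.
  have : ucvg F (fun x => u x (p + h) - u x p - L x h) (f (p + h) - f p - l h).
    apply: ucvgB => //; apply: ucvgB; apply: uf => //.
    by rewrite addrC addKr; lra.
  move/ucvg_le; apply; apply: filterS FS => x Sx /=; have [hu uB] := Sx.
  by apply: (holo_taylor hu uB hr) (LP x Sx); exact: linearP.
move=> e e0; pose K := `|8 * B / r ^+ 2| + 1.
have K0 : 0 < K by rewrite ltr_wpDl.
exists (Order.min r (e / K)) => [|h]; first by rewrite lt_min r0 divr_gt0.
rewrite lt_min => /andP[/est hr]; rewrite ltr_pdivlMr// => hK.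
apply: le_trans hr _; rewrite expr2 mulrA ler_wpM2r ?nrm_ge0//.
apply: le_trans (ltW hK); rewrite mulrC ler_wpM2l ?nrm_ge0//.
by rewrite /K; have := ler_norm (8 * B / r ^+ 2); lra.
Qed.

End Frechet.

(** * The domains [V_n] *)

Section Domains.
Context {R : realType} {k : nat}.
Local Notation C := R[i].
Local Notation E := ('rV[C]_k * C)%type.
Implicit Types p q : E.

Lemma ler_coord_norm (K : numFieldType) m n (x : 'M[K]_(m, n)) i j :
  `|x i j| <= `|x|.
Proof.
rewrite [leRHS](_ : _ = mx_norm x)// mx_normE -[leLHS]nngE num_le.
exact: (le_bigmax _ (fun ij : 'I_m * 'I_n => `|x ij.1 ij.2|%:nng) (i, j)).
Qed.

Lemma nrm_fst p : nrm p.1 <= nrm p.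
Proof. by rewrite -lecR -!normE prod_normE comparable_le_max ?lexx// real_comparable. Qed.

Lemma nrm_snd p : cabs p.2 <= nrm p.
Proof.
rewrite -nrmc -lecR -!normE prod_normE comparable_le_max ?lexx ?orbT//.
exact: real_comparable.
Qed.

Lemma nrm_coord p i : cabs (p.1 0 i) <= nrm p.
Proof.
apply: le_trans (nrm_fst p); rewrite -nrmc -lecR -!normE; exact: ler_coord_norm.
Qed.

Lemma Re_rv_lip p q : `|Re_rv p.1 - Re_rv q.1| <= nrm (p - q).
Proof.
rewrite [leLHS](_ : _ = mx_norm (Re_rv p.1 - Re_rv q.1))// mx_normrE.
apply: bigmax_le; first exact: nrm_ge0.
move=> [i j] _ /=; rewrite !mxE; apply: le_trans (nrm_coord (p - q) j).
rewrite (ord1 i) !mxE; apply: le_trans (cabs_Re _); apply: ler_refl_eq.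
by congr `|_|; case: (p.1 0 j) => a b; case: (q.1 0 j).
Qed.

(** The constant [k.+1] dominates the square root of [k] and is positive also for [k = 0]. *)
Lemma eucl_dist_le (x y : 'rV[R]_k) : eucl_dist x y <= k.+1%:R * `|x - y|.
Proof.
rewrite /eucl_dist -[leRHS]ger0_norm ?mulr_ge0// -sqrtr_sqr.
apply: ler_wsqrtr; apply: (@le_trans _ _ (\sum_(i < k) `|x - y| ^+ 2)).
  apply: ler_sum => i _; rewrite -[leLHS]real_normK ?num_real//.
  rewrite ler_sqr ?nnegrE//; have := ler_coord_norm (x - y) 0 i.
  by rewrite !mxE.
rewrite sumr_const card_ord -[leLHS]mulr_natl exprMn ler_wpM2r ?sqr_ge0//.
by rewrite -natrX ler_nat -mulnn; apply: leq_trans (leqnSn _) (leq_pmulr _ _).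
Qed.

Lemma near_lip (phi : E -> R) (K : R) p (a : R) :
  (forall q, `|phi q - phi p| <= K * nrm (q - p)) -> phi p < a ->
  \forall q \near p, phi q < a.
Proof.
move=> phiK pa; apply/nbhs_nrmP.
have K1 : 0 < `|K| + 1 by rewrite ltr_wpDl.
exists ((a - phi p) / (`|K| + 1)) => [|q]; first by rewrite divr_gt0 ?subr_gt0.
rewrite ltr_pdivlMr// => qp; have := phiK q.
have := ler_norm (phi q - phi p).
have : K * nrm (q - p) <= nrm (q - p) * (`|K| + 1).
  by rewrite mulrC ler_wpM2l ?nrm_ge0//; have := ler_norm K; lra.
lra.
Qed.

Lemma cabs_lip z w : `|cabs z - cabs w| <= cabs (z - w) :> R.
Proof.
rewrite ler_norml; have := ler_cabsB z w; have := ler_cabsB w z.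
by rewrite (cabsBC w); lra.
Qed.

Lemma Im_lip p q i :
  `|(`|complex.Im (p.1 0 i)| - `|complex.Im ((q : E).1 0 i)|)| <= nrm (p - q).
Proof.
apply: le_trans (ler_dist_dist _ _) _; apply: le_trans (nrm_coord (p - q) i).
rewrite !mxE; apply: le_trans (cabs_Im _); apply: ler_refl_eq.
by congr `|_|; case: (p.1 0 i) => a b; case: (q.1 0 i).
Qed.

Lemma snd_lip p q : `|cabs p.2 - cabs q.2| <= nrm (p - q).
Proof. exact: le_trans (cabs_lip _ _) (nrm_snd (p - q)). Qed.

(** Suitable [u], [v], [w] turn this one linear form into the bounds on [|zeta|], the angle
    condition and the bounds on the imaginary parts. *)
Lemma near_snd_Im_lt p i (u v w t : R) : (u * complex.Re p.2 + v * cabs p.2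
    + w * `|complex.Im (p.1 0 i)| < t) ->
  \forall q \near p, u * complex.Re q.2 + v * cabs q.2
    + w * `|complex.Im ((q : E).1 0 i)| < t.
Proof.
apply: (@near_lip (fun q : E => u * complex.Re q.2 + v * cabs q.2
    + w * `|complex.Im ((q : E).1 0 i)|) (`|u| + `|v| + `|w|)) => q.
have -> : u * complex.Re q.2 + v * cabs q.2 + w * `|complex.Im ((q : E).1 0 i)| -
  (u * complex.Re p.2 + v * cabs p.2 + w * `|complex.Im (p.1 0 i)|) =
  u * (complex.Re q.2 - complex.Re p.2) + v * (cabs q.2 - cabs p.2) +
  w * (`|complex.Im ((q : E).1 0 i)| - `|complex.Im (p.1 0 i)|) by ring.
apply: le_trans (ler_normD _ _) _.
apply: le_trans (lerD (ler_normD _ _) (lexx _)) _.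
rewrite !normrM !mulrDl; apply: lerD; first apply: lerD.
- apply: ler_wpM2l => //; apply: le_trans (nrm_snd (q - p)).
  apply: le_trans (cabs_Re _); apply: ler_refl_eq.
  by congr `|_|; rewrite /=; case: q.2 => a b; case: p.2.
- by apply: ler_wpM2l => //; exact: snd_lip.
- by apply: ler_wpM2l => //; exact: Im_lip.
Qed.

(** Kept apart from the previous lemma since no index [i] exists when [k = 0]. *)
Lemma near_snd_lt p (u v t : R) : (u * complex.Re p.2 + v * cabs p.2 < t) ->
  \forall q \near p, u * complex.Re (q : E).2 + v * cabs q.2 < t.
Proof.
apply: (@near_lip (fun q : E => u * complex.Re q.2 + v * cabs q.2)
  (`|u| + `|v|)) => q.
have -> : u * complex.Re q.2 + v * cabs q.2 -
  (u * complex.Re p.2 + v * cabs p.2) =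
  u * (complex.Re q.2 - complex.Re p.2) + v * (cabs q.2 - cabs p.2) by ring.
apply: le_trans (ler_normD _ _) _.
rewrite !normrM !mulrDl; apply: lerD.
- apply: ler_wpM2l => //; apply: le_trans (nrm_snd (q - p)).
  apply: le_trans (cabs_Re _); apply: ler_refl_eq.
  by congr `|_|; rewrite /=; case: q.2 => a b; case: p.2.
- by apply: ler_wpM2l => //; exact: snd_lip.
Qed.

Lemma near_Re_rv p (A : set 'rV[R]_k) :
  nbhs (Re_rv p.1) A -> \forall q \near p, A (Re_rv q.1).
Proof.
move=> /nbhs_ballP[e /= e0 eA]; apply/nbhs_nrmP; exists e => // q qp.
apply: eA; rewrite -ball_normE /=; apply: le_lt_trans qp.
by rewrite distrC; exact: Re_rv_lip.
Qed.

(** The absolute value of [arg z] is [acos (Re z / |z|)] for either sign of the imaginary part, and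
    [cos] decreases on [[0, pi]]. The angle condition thus becomes one between continuous functions
    of [z]. *)
Lemma arg_lt (a : R) (z : C) : 0 < a <= pi -> 0 < cabs z ->
  (`|arg z| < a) = (cos a * cabs z < complex.Re z).
Proof.
move=> /andP[a0 api] z0.
set c := complex.Re z / cabs z.
have c1 : -1 <= c <= 1.
  by rewrite -ler_norml normrM normfV (ger0_norm (cabs_ge0 z)) ler_pdivrMr// mul1r cabs_Re.
have -> : `|arg z| = acos c.
  by rewrite /arg -/(cabs z) -/c; case: ifP => _; rewrite ?normrN ger0_norm ?acos_ge0.
rewrite -ltr_pdivlMr// -/c -[in RHS](acosK (x := c)) ?in_itv//=.
by rewrite ltr_cos// in_itv/= ?(ltW a0)// acos_ge0//= acos_lepi.
Qed.

Context {Omega : set 'rV[R]_k} (O : admissible_seq Omega).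

Lemma adm_sep n : (1 <= n)%N -> exists2 d : R, 0 < d &
  forall x y, O n.+1 x -> Omega y -> ~ O n y -> d <= `|x - y|.
Proof.
move=> n1; have := adm_dist O n1; rewrite /set_dist; set S := (X in ereal_inf X) => S0.
have [d d0 hd] : exists2 d : R, 0 < d &
    forall x y, O n.+1 x -> Omega y -> ~ O n y -> d <= eucl_dist x y.
  have lb x y : O n.+1 x -> Omega y -> ~ O n y ->
      (ereal_inf S <= (eucl_dist x y)%:E)%E.
    by move=> Ox Oy nOy; apply: ereal_inf_lbound; exists (x, y).
  move: S0 lb; case: (ereal_inf S) => [d|_|//]; last first.
    (* An infinite distance means that there is no such pair of points, and any [d] will do. *)
    by move=> lb; exists 1 => // x y Ox Oy nOy; have := lb _ _ Ox Oy nOy.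
  by rewrite lte_fin => d0 lb; exists d => // x y Ox Oy nOy; rewrite -lee_fin lb.
exists (d / k.+1%:R) => [|x y Ox Oy nOy]; first by rewrite divr_gt0.
rewrite ler_pdivrMr// mulrC; exact: le_trans (hd _ _ Ox Oy nOy) (eucl_dist_le _ _).
Qed.

Lemma inv_nat_le_pi n : (1 <= n)%N -> 0 < (n%:R^-1 : R) <= pi.
Proof.
move=> n1; rewrite invr_gt0 ltr0n n1 /=.
apply: (@le_trans _ _ 1); first by rewrite invf_le1 ?ltr0n// ler1n.
by apply: le_trans (pi_ge2 R); lra.
Qed.

Lemma inv_nat_lt n : (1 <= n)%N -> (n.+1%:R^-1 : R) < n%:R^-1.
Proof. by move=> n1; rewrite ltf_pV2 ?posrE ?ltr0n// ltr_nat. Qed.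

Lemma dom_BE n p : dom_B O n p <-> [/\ O n (Re_rv p.1), 0 < cabs p.2,
  cabs p.2 < n%:R^-1 & forall i, `|complex.Im (p.1 0 i)| < n%:R^-1].
Proof. by split=> [[? /andP[]]|[? ? ? ?]] //; split=> //; exact/andP. Qed.

Lemma dom_AE n p : (1 <= n)%N -> dom_A O n p <->
  [/\ Omega (Re_rv p.1) /\ ~ O n.+1 (Re_rv p.1),
   cos n%:R^-1 * cabs p.2 < complex.Re p.2,
   0 < cabs p.2, cabs p.2 < n%:R^-1 &
   forall i, `|complex.Im (p.1 0 i)| < n%:R^-1 * cabs p.2].
Proof.
move=> n1; split=> [[? pa /andP[p0 ?] ?]|[? pa p0 ? ?]]; split=> //.
- by rewrite -arg_lt ?inv_nat_le_pi.
- by rewrite arg_lt ?inv_nat_le_pi.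
- exact/andP.
Qed.

Lemma dom_AB n p : (1 <= n)%N -> dom_A O n p -> O n (Re_rv p.1) -> dom_B O n p.
Proof.
move=> n1 /(dom_AE _ n1)[_ _ p0 pn yp] Op; apply/dom_BE; split=> // i.
apply: lt_le_trans (yp i) _; rewrite ler_piMr ?invr_ge0//.
by apply: le_trans (ltW pn) _; rewrite invf_le1 ?ltr0n// ler1n.
Qed.

(** The one condition that is not open is [x] outside [O n.+1]. Over [O n] it is avoided by passing
    to [dom_B]; over the rest of [Omega] it persists nearby because [O n.+1] stays at a positive
    distance. *)
Lemma dom_V_open n p : open Omega -> (1 <= n)%N -> dom_V O n p ->
  \forall q \near p, dom_V O n q.
Proof.
move=> oOmega n1 Vp; have [Op|nOp] := pselect (O n (Re_rv p.1)).
  have /dom_BE[_ p0 pn yp] : dom_B O n p by case: Vp => // /dom_AB; exact.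
  have h1 := near_Re_rv (open_nbhs_nbhs (conj (@adm_open _ _ _ O _ n1) Op)).
  have h2 := @near_snd_lt p 0 (-1) 0 ltac:(lra).
  have h3 := @near_snd_lt p 0 1 n%:R^-1 ltac:(lra).
  have h4 : \forall q \near p, forall i, `|complex.Im ((q : E).1 0 i)| < n%:R^-1.
    apply: (@filter_forall E 'I_k (fun i q =>
      `|complex.Im (q.1 0 i)| < n%:R^-1) (nbhs p) (nbhs_filter p)) => i.
  have ypi := yp i.
    have := @near_snd_Im_lt p i 0 0 1 n%:R^-1 ltac:(lra).
    by apply: filterS => q; lra.
  near=> q; right; apply/dom_BE; split.
  - by near: q.
  - suff : 0 * complex.Re q.2 + -1 * cabs q.2 < 0 by lra.
    by near: q.
  - suff : 0 * complex.Re q.2 + 1 * cabs q.2 < n%:R^-1 by lra.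
    by near: q.
  - by near: q.
have [Ap|[]//] := Vp; have /(dom_AE _ n1)[[Ox nOx] pa p0 pn yp] := Ap.
have [d d0 sep] := adm_sep n1.
have h0 := near_Re_rv (open_nbhs_nbhs (conj oOmega Ox)).
have h1 := @near_snd_lt p (-1) (cos n%:R^-1) 0 ltac:(lra).
have h2 := @near_snd_lt p 0 (-1) 0 ltac:(lra).
have h3 := @near_snd_lt p 0 1 n%:R^-1 ltac:(lra).
have h4 : \forall q \near p,
    forall i, `|complex.Im ((q : E).1 0 i)| < n%:R^-1 * cabs q.2.
  apply: (@filter_forall E 'I_k (fun i q =>
    `|complex.Im (q.1 0 i)| < n%:R^-1 * cabs q.2) (nbhs p) (nbhs_filter p)) => i.
  have ypi := yp i.
  have := @near_snd_Im_lt p i 0 (- n%:R^-1) 1 0 ltac:(lra).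
  by apply: filterS => q; lra.
have h5 : \forall q \near p, ~ O n.+1 (Re_rv q.1).
  apply/nbhs_nrmP; exists d => // q qp Oq; have := sep _ _ Oq Ox nOp.
  by have := Re_rv_lip q p; lra.
near=> q; left; apply/dom_AE => //; split.
- by split; near: q.
- suff : -1 * complex.Re q.2 + cos n%:R^-1 * cabs q.2 < 0 by lra.
  by near: q.
- suff : 0 * complex.Re q.2 + -1 * cabs q.2 < 0 by lra.
  by near: q.
- suff : 0 * complex.Re q.2 + 1 * cabs q.2 < n%:R^-1 by lra.
  by near: q.
- by near: q.
Unshelve. all: by end_near. Qed.

(* Contrapositive of: the closure of [V_{n+1}] meets [Omega x C^*] inside [V_n]. *)
Lemma dom_V_closure n p : (1 <= n)%N -> Omega (Re_rv p.1) -> 0 < cabs p.2 ->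
  ~ dom_V O n p -> \forall q \near p, ~ dom_V O n.+1 q.
Proof.
move=> n1 Ox p0 nVp.
have [b bE] : exists b : R, b = n.+1%:R^-1 by eexists.
have nn : b < n%:R^-1 by rewrite bE; exact: inv_nat_lt.
have b0 : 0 < b by rewrite bE invr_gt0.
have b1 : b <= 1 by rewrite bE invf_le1 ?ler1n.
have Aq q : dom_A O n.+1 q -> [/\ cos b * cabs q.2 < complex.Re q.2,
    0 < cabs q.2, cabs q.2 < b &
    forall i, `|complex.Im ((q : E).1 0 i)| < b * cabs q.2].
  by move=> /(dom_AE _ (ltn0Sn n))[]; rewrite -bE.
have Vq q : dom_V O n.+1 q -> [/\ 0 < cabs q.2, cabs q.2 < b &
    forall i, `|complex.Im ((q : E).1 0 i)| < b].
  case=> [/Aq[_ q0 qn yq]|/dom_BE[_ q0]]; last by rewrite -bE.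
  split=> // i; apply: lt_le_trans (yq i) _; rewrite ler_piMr ?(ltW b0)//; lra.
(* A bound of [V_n] that fails at [p], even with equality, fails strictly for [V_{n+1}], where [1/n]
   has become smaller and [cos (1/n)] larger; a strict failure persists near [p]. *)
have [pn|pn] := leP n%:R^-1 (cabs p.2).
  have := @near_snd_lt p 0 (-1) (- b) ltac:(lra).
  by apply: filterS => q hq /Vq[]; lra.
have [Op|nOp] := pselect (O n (Re_rv p.1)).
  have /existsNP[i /negP] : ~ forall i, `|complex.Im (p.1 0 i)| < n%:R^-1.
    by move=> yp; apply: nVp; right; apply/dom_BE.
  rewrite -leNgt => yi.
  have := @near_snd_Im_lt p i 0 0 (-1) (- b) ltac:(lra).
  by apply: filterS => q hq /Vq[_ _ /(_ i)]; lra.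
(* Here separation keeps [dom_B] away, and as [p] also lies off [O n.+1], membership in [dom_A] at
   level [n] can fail only by the angle or an imaginary part. *)
have [d d0 sep] := adm_sep n1.
have nB : \forall q \near p, ~ dom_B O n.+1 q.
  apply/nbhs_nrmP; exists d => // q qp /dom_BE[Oq _ _ _].
  by have := sep _ _ Oq Ox nOp; have := Re_rv_lip q p; lra.
suff nA : \forall q \near p, ~ dom_A O n.+1 q.
  by apply: filterS (filterI nA nB) => q [h1 h2] [/h1|/h2].
have nOp' : ~ O n.+1 (Re_rv p.1) by move=> /(adm_decr n1).
have cosn : cos n%:R^-1 < cos b.
  have /andP[? ?] := @inv_nat_le_pi n n1; have /andP[? ?] := @inv_nat_le_pi n.+1 (ltn0Sn n).
  by rewrite ltr_cos// in_itv/= ?bE ltW.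
have [pa|pa] := leP (complex.Re p.2) (cos n%:R^-1 * cabs p.2).
  have pa' : complex.Re p.2 < cos b * cabs p.2.
    by apply: le_lt_trans pa _; rewrite ltr_pM2r.
  have := @near_snd_lt p 1 (- cos b) 0 ltac:(lra).
  by apply: filterS => q hq /Aq[]; lra.
have /existsNP[i /negP] : ~ forall i, `|complex.Im (p.1 0 i)| < n%:R^-1 * cabs p.2.
  by move=> yp; apply: nVp; left; apply/dom_AE.
rewrite -leNgt => yi.
have yi' : b * cabs p.2 < n%:R^-1 * cabs p.2 by rewrite ltr_pM2r.
have := @near_snd_Im_lt p i 0 b (-1) 0 ltac:(lra).
by apply: filterS => q hq /Aq[_ _ _ /(_ i)]; lra.
Qed.

Lemma dom_VS n : (1 <= n)%N -> dom_V O n.+1 `<=` dom_V O n.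
Proof.
move=> n1 p Vp; apply: contrapT => nVp.
have := dom_V_closure n1 (dom_V_Omega Vp) (dom_V_normc_gt0 Vp) nVp.
by move/nbhs_singleton; exact.
Qed.

End Domains.

(** For restrictions extended by 0, which agree with the original function only near the points of
    the smaller domain. *)
Lemma near_differentiable (R : realType) (V : normedModType R[i]) (f g : V -> R[i]) p :
  (\forall q \near p, f q = g q) -> differentiable f p -> differentiable g p.
Proof.
move=> fg /diff_locallyP[dc /eqaddoP fo].
have fgp : f p = g p by exact: nbhs_singleton fg.
have [r r0 hr] := (nbhs_nrmP _ _).1 fg.
have go : g \o shift p = cst (g p) + 'd f p +o_ 0 id.
  apply/eqaddoP => e e0; have [d d0 hd] := (nbhs_nrmP _ _).1 (fo e e0).
  apply/nbhs_nrmP; exists (Order.min r d) => [|h]; first by rewrite lt_min r0.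
  rewrite lt_min => /andP[rh /hd].
  rewrite -[X in `|X| <= _ -> _]/(f (h + p) - (f p + 'd f p h)).
  rewrite -[X in _ -> `|X| <= _]/(g (h + p) - (g p + 'd f p h)).
  by rewrite -fgp -hr// addrK; move: rh; rewrite subr0.
by apply/diff_locallyP; rewrite (diff_unique dc go).
Qed.

(** * Distance to the boundary and the weight [psi] *)

Section BoundaryDistance.
Context {R : realType} {k : nat} (Omega : set 'rV[R]_k).
Implicit Types x y : 'rV[R]_k.

(* Truncated at 1, so that it is finite when [Omega] is the whole space. *)
Definition bdist x : R :=
  inf ([set 1] `|` [set `|x - y| | y in ~` Omega]).

Let bdist_lbound x : lbound ([set 1] `|` [set `|x - y| | y in ~` Omega]) 0.
Proof. by move=> _ [->//|[y _ <-]]. Qed.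

Lemma bdist_le1 x : bdist x <= 1.
Proof. by apply: ge_inf; [exists 0; exact: bdist_lbound|left]. Qed.

Lemma bdist_le x y : ~ Omega y -> bdist x <= `|x - y|.
Proof. by move=> Oy; apply: ge_inf; [exists 0; exact: bdist_lbound|right; exists y]. Qed.

Lemma le_bdist x (a : R) : a <= 1 -> (forall y, ~ Omega y -> a <= `|x - y|) ->
  a <= bdist x.
Proof.
move=> a1 ay; apply: lb_le_inf; first by exists 1; left.
by move=> _ [->//|[y Oy <-]]; exact: ay.
Qed.

Lemma bdist_gt0 x : open Omega -> Omega x -> 0 < bdist x.
Proof.
move=> oO Ox; have /nbhs_ballP[e /= e0 eO] := open_nbhs_nbhs (conj oO Ox).
apply: (@lt_le_trans _ _ (Order.min 1 e)); first by rewrite lt_min ltr01.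
apply: le_bdist => [|y Oy]; first by rewrite ge_min lexx.
rewrite leNgt; apply/negP => xy; apply: Oy; apply: eO.
by rewrite -ball_normE /=; move: xy; rewrite lt_min => /andP[].
Qed.

Lemma bdist_Omega x : 0 < bdist x -> Omega x.
Proof.
move=> x0; apply: contrapT => /(bdist_le x); rewrite subrr normr0; lra.
Qed.

Lemma bdist_lip x y : `|bdist x - bdist y| <= `|x - y|.
Proof.
suff H u v : bdist u - bdist v <= `|u - v|.
  by rewrite ler_norml; have := H x y; have := H y x; rewrite (distrC y); lra.
rewrite lerBlDl -lerBlDr; apply: le_bdist => [|z Oz].
  by have := bdist_le1 u; have := normr_ge0 (u - v); lra.
by have := bdist_le u Oz; have := ler_distD v u z; lra.
Qed.

Lemma bdist_continuous : continuous bdist.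
Proof.
move=> x A /nbhs_ballP[e /= e0 eA]; apply/nbhs_ballP; exists e => // y xy.
apply: eA; rewrite -ball_normE /=; apply: le_lt_trans (bdist_lip x y) _.
by move: xy; rewrite -ball_normE.
Qed.

Definition exhaust x : R := 1 + `|x| + (bdist x)^-1.

Lemma exhaust_ge1 x : Omega x -> open Omega -> 1 <= exhaust x.
Proof.
move=> Ox oO; have := bdist_gt0 oO Ox; rewrite -invr_gt0 /exhaust.
by have := normr_ge0 x; lra.
Qed.

(* [exhaust] tends to infinity at the boundary of [Omega] and at infinity, so
   [phi / psi] tends to 0 there. *)
Lemma exhaust_weight (phi : weight Omega) : open Omega ->
  exists psi : weight Omega, forall x, psi x = (1 + phi x) * exhaust x.
Proof.
move=> oO.
have psic : {within Omega, continuous (fun x => (1 + phi x) * exhaust x)}.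
  rewrite continuous_open_subspace// => x Ox.
  have phic : {for x, continuous phi}.
    have := @weight_continuous _ _ _ phi; rewrite continuous_open_subspace//.
    exact.
  have invc : {for x, continuous (fun x => (bdist x)^-1)}.
    apply: continuousV; last exact: bdist_continuous.
    by rewrite gt_eqF// bdist_gt0//; exact/set_mem.
  have normc : {for x, continuous (fun x : 'rV[R]_k => `|x|)}.
    exact: norm_continuous.
  have onec : {for x, continuous (cst (1 : R) : 'rV[R]_k -> R)}.
    exact: cst_continuous.
  exact: (continuousM (continuousD onec phic)
    (continuousD (continuousD onec normc) invc)).
have psi0 x : Omega x -> 0 < (1 + phi x) * exhaust x.
  move=> Ox; have := weight_gt0 phi Ox; have := exhaust_ge1 Ox oO => e1 p1.
  by rewrite mulr_gt0//; lra.
by exists (Weight psic psi0).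
Qed.

End BoundaryDistance.

(** * The restriction operator *)

Section Restriction.
Context {R : realType} {k : nat} {Omega : set 'rV[R]_k}.
Variables (O : admissible_seq Omega) (n : nat) (phi psi : weight Omega).
Hypothesis n_ge1 : (1 <= n)%N.
Hypothesis Omega_open : open Omega.
Hypothesis phi_le_psi : forall x, Omega x -> phi x <= psi x.
Local Notation C := R[i].
Local Notation E := ('rV[C]_k * C)%type.

(** Elements of the target space vanish off [V_{n+1}], so the restriction has to be cut off
    there. *)
Let restr (f : E -> C) (p : E) : C := if pselect (dom_V O n.+1 p) then f p else 0.

Let restrE (f : E -> C) p : dom_V O n.+1 p -> restr f p = f p.
Proof. by rewrite /restr; case: pselect. Qed.

Lemma dom_V_lt m p : dom_V O m p -> cabs p.2 < m%:R^-1.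
Proof. by case=> -[_]; [move=> _ /andP[]|move=> /andP[]]. Qed.

(** The same constant [c] works: [phi <= psi], and [|zeta| <= 1] on [V_{n+1}], so the higher power
    of [1 / |zeta|] is the larger one. *)
Lemma in_H_restr (f : H O n phi) : in_H O n.+1 psi (restr f).
Proof.
have [f0 df [c c0 fc]] := H_in f; split.
- by move=> p nVp; rewrite /restr; case: pselect.
- move=> p Vp; apply: near_differentiable (df p (dom_VS n_ge1 Vp)).
  by apply: filterS (dom_V_open Omega_open (ltn0Sn n) Vp) => q /restrE ->.
- exists c => // p Vp; rewrite restrE//; apply: le_trans (fc p (dom_VS n_ge1 Vp)) _.
  have Ox := dom_V_Omega Vp; have p0 : 0 < cabs p.2 := dom_V_normc_gt0 Vp.
  have p1 : cabs p.2 <= 1.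
    by apply: le_trans (ltW (dom_V_lt Vp)) _; rewrite invf_le1 ?ler1n.
  rewrite -!mulrA ler_pM2l// -/(cabs p.2) ler_pM ?phi_le_psi//.
  + exact/ltW/weight_gt0.
  + by rewrite invr_ge0 exprn_ge0// ltW.
  + by rewrite lef_pV2 ?posrE ?exprn_gt0// exprS ler_piMl// exprn_ge0// ltW.
Qed.

Definition restrict_H (f : H O n phi) : H O n.+1 psi :=
  MkH (introT (H_predP _ _ _ _) (in_H_restr f)).

Lemma restrict_HE (f : H O n phi) p : dom_V O n.+1 p -> restrict_H f p = f p.
Proof. exact: restrE. Qed.

Lemma restrict_H_linear : linear restrict_H.
Proof.
move=> a f g; apply: H_eq => p Vp; rewrite restrict_HE//.
by rewrite -[RHS]/(a *: restrict_H f p + restrict_H g p) !restrict_HE.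
Qed.

End Restriction.

(** * Montel's theorem for bounded families in [H_{n,phi}] *)

Section Compactness.
Context {R : realType} {k : nat} {Omega : set 'rV[R]_k}.
Variables (O : admissible_seq Omega) (n : nat) (phi : weight Omega).
Hypothesis n_ge1 : (1 <= n)%N.
Hypothesis Omega_open : open Omega.
Local Notation C := R[i].
Local Notation E := ('rV[C]_k * C)%type.

Lemma nrm_H m (chi : weight Omega) (f : H O m chi) : nrm f = H_norm f.
Proof. by []. Qed.

Lemma H_bound (f : H O n phi) (M : R) (p : E) : H_norm f <= M ->
  dom_V O n p -> cabs (f p) <= M * (phi (Re_rv p.1) / cabs p.2 ^+ n).
Proof.
move=> fM Vp; have := le_trans (H_norm_ub f Vp) fM.
have x0 := weight_gt0 phi (dom_V_Omega Vp).
have p0 : 0 < cabs p.2 := dom_V_normc_gt0 Vp.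
rewrite -/(cabs p.2) -/(cabs (f p)) ler_pdivrMr// => h.
by rewrite mulrA ler_pdivlMr ?exprn_gt0// mulrC.
Qed.

(** By [H_bound], [B] then bounds the whole unit ball of [H_{n,phi}] near [p]. It comes from
    continuity of [phi] and from [|q.2| > |p.2| / 2]. *)
Lemma local_bound (p : E) : dom_V O n p -> exists r B : R,
  [/\ 0 < r, 0 <= B & forall q, nrm (q - p) < r -> dom_V O n q /\
    phi (Re_rv q.1) / cabs q.2 ^+ n <= B].
Proof.
move=> Vp; have Ox := dom_V_Omega Vp.
have p0 : 0 < cabs p.2 := dom_V_normc_gt0 Vp.
have phic : {for Re_rv p.1, continuous phi}.
  have := @weight_continuous _ _ _ phi; rewrite continuous_open_subspace//.
  by apply; exact/mem_set.
have phin : \forall q \near p, phi (Re_rv q.1) < phi (Re_rv p.1) + 1.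
  apply: (@near_Re_rv _ _ p [set x | phi x < phi (Re_rv p.1) + 1]).
  have h : nbhs (Re_rv p.1) (phi @^-1` ball (phi (Re_rv p.1)) 1).
    exact: phic _ (nbhsx_ballx _ 1 ltr01).
  apply: filterS h => x.
  by rewrite /ball /= ltr_norml => /andP[]; lra.
have sn := @near_snd_lt _ _ p 0 (-1) (- (cabs p.2 / 2)) ltac:(lra).
have Vn := dom_V_open Omega_open n_ge1 Vp.
have [r r0 hr] := (nbhs_nrmP _ _).1 (filterI Vn (filterI phin sn)).
have c0 : 0 < cabs p.2 / 2 by rewrite divr_gt0.
have x0 := weight_gt0 phi Ox.
exists r, ((phi (Re_rv p.1) + 1) / (cabs p.2 / 2) ^+ n); split => //.
  by rewrite divr_ge0 ?exprn_ge0 ?(ltW c0)//; lra.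
move=> q /hr[Vq [qphi qs]]; split=> //.
have q2 : cabs p.2 / 2 < cabs q.2 by lra.
have xq := weight_gt0 phi (dom_V_Omega Vq).
rewrite ler_pM ?invr_ge0 ?exprn_ge0 ?cabs_ge0 ?(ltW xq) ?(ltW qphi)//.
rewrite lef_pV2 ?posrE ?exprn_gt0 ?(lt_trans c0 q2)//.
by apply: lerXn2r; rewrite ?nnegrE ?(ltW q2) ?(ltW c0) ?cabs_ge0.
Qed.

Lemma H_holo (f : H O n phi) (p : E) (r : R) :
  (forall q, nrm (q - p) < r -> dom_V O n q) -> holo_ball f p r.
Proof.
move=> hr q /hr Vq; have [_ df _] := H_in f.
by exists ('d f q); exact: differentiable_ediff (df q Vq).
Qed.

Section Limit.
Variables (M : R) (F : set_system (H O n phi)).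
Hypothesis UF : UltraFilter F.
Hypothesis FM : F [set f | H_norm f <= M].

(** Pointwise limits exist by [ultra_ucvg], are holomorphic by [ucvg_differentiable], and inherit
    the pointwise form of the norm bound. *)
Lemma montel_limit : exists g : H O n phi,
  H_norm g <= M /\ forall p, ucvg F (fun f : H O n phi => f p) (g p).
Proof.
have M0 : 0 <= M.
  by have [f fM] := filter_ex FM; exact: le_trans (H_norm_ge0 f) fM.
have /choice[g gP] : forall p : E, exists l,
    ucvg F (fun f : H O n phi => f p) l /\ (~ dom_V O n p -> l = 0).
  move=> p; have [Vp|nVp] := pselect (dom_V O n p); last first.
    exists 0; split=> //; rewrite (_ : (fun f => _) = fun=> 0); first exact: ucvg_cst.
    by apply/funext => f; have [-> //] := H_in f.
  have [|l ul] := @ultra_ucvg _ _ F (fun f : H O n phi => f p)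
      (M * (phi (Re_rv p.1) / cabs p.2 ^+ n)) UF.
    by apply: filterS FM => f fM; exact: H_bound.
  by exists l.
have gB p : dom_V O n p -> cabs (g p) <= M * (phi (Re_rv p.1) / cabs p.2 ^+ n).
  move=> Vp; apply: (ucvg_le (gP p).1).
  by apply: filterS FM => f fM; exact: H_bound.
have gH : in_H O n phi g.
  split.
  - by move=> p nVp; exact: (gP p).2.
  - move=> p Vp; have [r [B [r0 B0 hr]]] := local_bound Vp.
    have r2 : 2 * (r / 2) = r by field.
    apply: (@ucvg_differentiable _ _ _ F (fun f : H O n phi => f) g p (r / 2)
      (M * B) UF); first by rewrite divr_gt0.
    + rewrite r2; apply: filterS FM => f fM; split.
        by apply: H_holo => q /hr[].
      move=> q /hr[Vq qB]; apply: le_trans (H_bound fM Vq) _.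
      exact: ler_wpM2l.
    + by move=> q _; exact: (gP q).1.
  (* The constant in [in_H] must be positive, and [M] may be 0. *)
  - exists (M + 1); first by lra.
    move=> p Vp; rewrite -/(cabs (g p)) -mulrA; apply: le_trans (gB p Vp) _.
    have x0 := weight_gt0 phi (dom_V_Omega Vp).
    rewrite ler_wpM2r ?divr_ge0 ?exprn_ge0 ?cabs_ge0 ?(ltW x0)//; lra.
exists (MkH (introT (H_predP _ _ _ _) gH)); split; last by move=> p; exact: (gP p).1.
apply: H_norm_le => // p Vp; rewrite -/(cabs p.2) -/(cabs (g p)).
have x0 := weight_gt0 phi (dom_V_Omega Vp).
have p0 : 0 < cabs p.2 := dom_V_normc_gt0 Vp.
by rewrite ler_pdivrMr// mulrC -ler_pdivlMr ?exprn_gt0// -mulrA gB.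
Qed.

(** All [f] in the ball and [g] share a Lipschitz constant [K] near [p], so closeness at [p] spreads
    to a neighbourhood; each of the three differences takes a third of [e]. *)
Lemma locally_uniform (g : H O n phi) (p : E) (e : R) : 0 < e ->
  H_norm g <= M -> (forall p, ucvg F (fun f : H O n phi => f p) (g p)) ->
  dom_V O n p ->
  \forall q \near p & f \near F, cabs ((f : H O n phi) q - g q) <= e.
Proof.
move=> e0 gM gP Vp; have [r [B [r0 B0 hr]]] := local_bound Vp.
have M0 : 0 <= M := le_trans (H_norm_ge0 g) gM.
pose K := 4 * (M * B) / r.
have K0 : 0 <= K by rewrite divr_ge0 ?mulr_ge0// ltW.
have lip (f : H O n phi) q : H_norm f <= M -> nrm (q - p) < r ->
    cabs (f q - f p) <= K * nrm (q - p).
  move=> fM qr; have -> : q = p + (q - p) by rewrite addrC subrK.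
  rewrite [X in nrm X](_ : _ = q - p); last by rewrite addrAC subrr add0r.
  apply: holo_lipschitz qr => [|x /hr[Vx xB]]; first by apply: H_holo => x /hr[].
  by apply: le_trans (H_bound fM Vx) _; exact: ler_wpM2l.
have e3 : 0 < e / 3 by rewrite divr_gt0.
have K1 : 0 < K + 1 by lra.
exists ([set q | nrm (q - p) < Order.min r (e / 3 / (K + 1))],
  [set f : H O n phi | H_norm f <= M /\ cabs (f p - g p) < e / 3]).
  split=> /=; last exact: filterI FM (gP p _ e3).
  apply/nbhs_nrmP; exists (Order.min r (e / 3 / (K + 1))) => //.
  by rewrite lt_min r0 divr_gt0.
move=> [q f] /= [+ [fM fg]]; rewrite lt_min ltr_pdivlMr// => /andP[qr qe].
have := lip f q fM qr; have := lip g q gM qr.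
have -> : f q - g q = (f q - f p) + (f p - g p) - (g q - g p) by ring.
have := nrm_ge0 (q - p).
move=> h1 h2 h3.
apply: le_trans (le_cabsD _ _) _; rewrite cabsN.
by have := le_cabsD (f q - f p) (f p - g p); lra.
Qed.

End Limit.

End Compactness.

(** * Norm convergence and compactness of the restriction *)

Section CompactRestriction.
Context {R : realType} {k : nat} {Omega : set 'rV[R]_k}.
Variables (O : admissible_seq Omega) (n : nat) (phi psi : weight Omega).
Hypothesis n_ge1 : (1 <= n)%N.
Hypothesis Omega_open : open Omega.
Hypothesis psiE : forall x, psi x = (1 + phi x) * exhaust Omega x.
Hypothesis phi_le_psi : forall x, Omega x -> phi x <= psi x.
Local Notation C := R[i].
Local Notation E := ('rV[C]_k * C)%type.
Local Notation T := (restrict_H n_ge1 Omega_open phi_le_psi : H O n phi -> H O n.+1 psi).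

Lemma dom_V_Im m (p : E) i : (1 <= m)%N -> dom_V O m p ->
  `|complex.Im (p.1 0 i)| <= 1.
Proof.
move=> m1; have m1' : m%:R^-1 <= 1 :> R by rewrite invf_le1 ?ltr0n// ler1n.
case=> [/(dom_AE _ _ m1)[_ _ p0 pm yp]|/dom_BE[_ _ _ yp]].
  apply: le_trans (ltW (yp i)) _; rewrite mulr_ile1 ?invr_ge0 ?(ltW p0)//.
  exact: le_trans (ltW pm) m1'.
exact: le_trans (ltW (yp i)) m1'.
Qed.

Lemma polydisc_compact (r : R) :
  compact [set p : E | (forall i, cabs (p.1 0 i) <= r) /\ cabs p.2 <= r].
Proof.
have := compact_setX (@rV_compact C k (fun=> [set z | cabs z <= r])
  (fun=> @compact_disc R r)) (@compact_disc R r).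
by congr compact.
Qed.

(** A polydisc contains all the points in question, and near-covering compactness reduces the claim
    to each of its points. At points of [V_n] this is [locally_uniform]; around any other point one
    of the conditions on [p] fails, by [dom_V_closure] if the bounds by [c] hold. *)
Lemma uniform_on_exhaustion M (F : set_system (H O n phi)) (g : H O n phi)
    (c e : R) : UltraFilter F -> F [set f | H_norm f <= M] -> H_norm g <= M ->
  (forall p, ucvg F (fun f : H O n phi => f p) (g p)) -> 0 < c -> 0 < e ->
  F [set f | forall p : E, dom_V O n.+1 p -> c <= bdist Omega (Re_rv p.1) ->
    c <= cabs p.2 -> `|Re_rv p.1| <= c^-1 -> cabs (f p - g p) <= e].
Proof.
move=> UF FM gM gP c0 e0.
(* [c^-1] bounds the real parts, and 1 the imaginary parts and [|zeta|]. *)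
have := @polydisc_compact (c^-1 + 1).
move=> /compact_near_coveringP /(_ _ F (fun (f : H O n phi) (p : E) =>
  dom_V O n.+1 p -> c <= bdist Omega (Re_rv p.1) -> c <= cabs p.2 ->
  cabs (f p - g p) <= e) _) cov.
have c10 : 0 < c^-1 by rewrite invr_gt0.
apply: filterS (cov _) => [f fe p Vp pd pc px|p _]; last first.
  have bad : (\forall q \near p, ~ (dom_V O n.+1 q /\
      c <= bdist Omega (Re_rv q.1) /\ c <= cabs q.2)) ->
      \forall q \near p & f \near F, dom_V O n.+1 q ->
        c <= bdist Omega (Re_rv q.1) -> c <= cabs q.2 ->
        cabs ((f : H O n phi) q - g q) <= e.
    move=> nq; exists ([set q | ~ (dom_V O n.+1 q /\
      c <= bdist Omega (Re_rv q.1) /\ c <= cabs q.2)], setT).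
      by split => //=; exact: filterT.
    by move=> [q f] /= [nVq _] Vq q1 q2; exfalso; apply: nVq.
  have [Vp|nVp] := pselect (dom_V O n p).
    have [[A B] [/= nA FB] AB] := locally_uniform n_ge1 Omega_open UF FM e0 gM gP Vp.
    by exists (A, B) => // -[q f] /= qf _ _ _; exact: (AB (q, f)).
  have [pd|pd] := ltP (bdist Omega (Re_rv p.1)) c.
    apply: bad; have := @near_lip _ _ (fun q : E => bdist Omega (Re_rv q.1)) 1 p c.
    move=> h; have {}h := h _ pd; apply: filterS (h _) => [q qc|q]; first lra.
    by rewrite mul1r; apply: le_trans (bdist_lip _ _ _) (Re_rv_lip _ _).
  have [pc|pc] := ltP (cabs p.2) c.
    apply: bad; have := @near_snd_lt _ _ p 0 1 c ltac:(lra).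
    by apply: filterS => q; lra.
  apply: bad.
  have := dom_V_closure n_ge1 (bdist_Omega (lt_le_trans c0 pd)) (lt_le_trans c0 pc) nVp.
  by apply: filterS => q nVq [].
apply: fe => //; split.
  move=> i; apply: le_trans (_ : `|complex.Re (p.1 0 i)| + `|complex.Im (p.1 0 i)| <= _).
    rewrite [p.1 0 i in X in X <= _]complexE; apply: le_trans (le_cabsD _ _) _.
    by rewrite cabsM cabs_i mul1r !cabs_real.
  apply: lerD.
    apply: le_trans px; have := ler_coord_norm (Re_rv p.1) 0 i.
    by rewrite mxE.
  exact: (dom_V_Im i (ltn0Sn n) Vp).
apply: (@le_trans _ _ 1); last lra.
by apply: le_trans (ltW (dom_V_lt Vp)) _; rewrite invf_le1 ?ler1n.
Qed.

(** On the set of [uniform_on_exhaustion] the unweighted difference is small, and there [psi >= 1]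
    and [|zeta| <= 1]. Elsewhere the crude bound [2 M] for the difference suffices, thanks to the
    stronger weight. *)
Lemma restrict_H_cvg M (F : set_system (H O n phi)) (g : H O n phi) (e : R) :
  UltraFilter F -> F [set f | H_norm f <= M] -> H_norm g <= M ->
  (forall p, ucvg F (fun f : H O n phi => f p) (g p)) -> 0 < e ->
  F [set f | H_norm (T f - T g) <= e].
Proof.
move=> UF FM gM gP e0.
have M0 : 0 <= M := le_trans (H_norm_ge0 g) gM.
have M1 : 0 < 2 * M + 1 by lra.
pose c := Order.min 1 (e / (2 * M + 1)).
have c0 : 0 < c by rewrite lt_min ltr01 divr_gt0.
have ce : 2 * M * c <= e.
  have : c * (2 * M + 1) <= e by rewrite -ler_pdivlMr// ge_min lexx orbT.
  lra.
apply: filterS (filterI FM (uniform_on_exhaustion UF FM gM gP c0 e0)).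
move=> f [/= fM fe]; apply: H_norm_le => [|p Vp]; first exact: ltW.
rewrite -[(T f - T g) p]/(T f p - T g p) !restrict_HE//.
rewrite -/(cabs p.2) -/(cabs (f p - g p)).
have Ox := dom_V_Omega Vp; have Vnp := dom_VS n_ge1 Vp.
have p0 : 0 < cabs p.2 := dom_V_normc_gt0 Vp.
have p1 : cabs p.2 <= 1.
  by apply: le_trans (ltW (dom_V_lt Vp)) _; rewrite invf_le1 ?ler1n.
have x0 := weight_gt0 phi Ox; have s0 := weight_gt0 psi Ox.
have ex1 := exhaust_ge1 Ox Omega_open.
have ex0 : 0 < exhaust Omega (Re_rv p.1) by lra.
rewrite ler_pdivrMr//.
have fg : cabs (f p - g p) <= 2 * M * (phi (Re_rv p.1) / cabs p.2 ^+ n).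
  apply: le_trans (le_cabsD _ _) _; rewrite cabsN.
  by have := H_bound fM Vnp; have := H_bound gM Vnp; lra.
(* One of the factors [|zeta|] is traded for [c * exhaust]; then [2 M c <= e], and
   [phi * exhaust <= psi]. *)
have small : cabs p.2 <= c * exhaust Omega (Re_rv p.1) ->
    cabs p.2 ^+ n.+1 * cabs (f p - g p) <= e * psi (Re_rv p.1).
  move=> pc; apply: (@le_trans _ _ (cabs p.2 * (2 * M * phi (Re_rv p.1)))).
    rewrite exprS -(mulrA (cabs p.2)) ler_pM2l// mulrC -ler_pdivlMr ?exprn_gt0//.
    by rewrite -(mulrA (2 * M)).
  apply: (@le_trans _ _ (c * exhaust Omega (Re_rv p.1) * (2 * M * phi (Re_rv p.1)))).
    by apply: ler_wpM2r pc; rewrite !mulr_ge0// ltW.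
  have -> : c * exhaust Omega (Re_rv p.1) * (2 * M * phi (Re_rv p.1)) =
     2 * M * c * (phi (Re_rv p.1) * exhaust Omega (Re_rv p.1)) by ring.
  apply: ler_pM => //; first by rewrite !mulr_ge0// ltW.
    by rewrite mulr_ge0 ?ltW.
  by rewrite psiE ler_pM2r//; lra.
have d0 := bdist_gt0 Omega_open Ox.
(* There are three ways off the set. If [|zeta| < c], [small] applies since [exhaust >= 1]; near the
   boundary or far out it applies since [exhaust >= 1 / c] and [|zeta| <= 1]. *)
have [pc|pc] := ltP (cabs p.2) c.
  by apply: small; apply: le_trans (ltW pc) _; rewrite ler_peMr// ltW.
have [dc|dc] := ltP (bdist Omega (Re_rv p.1)) c.
  apply: small; apply: le_trans p1 _; rewrite mulrC -ler_pdivrMr// mul1r.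
  apply: (@le_trans _ _ (bdist Omega (Re_rv p.1))^-1).
    by rewrite lef_pV2 ?posrE ?ltW.
  by rewrite /exhaust; have := normr_ge0 (Re_rv p.1); lra.
have [xc|xc] := ltP c^-1 `|Re_rv p.1|.
  apply: small; apply: le_trans p1 _; rewrite mulrC -ler_pdivrMr// mul1r.
  by rewrite /exhaust; move: d0; rewrite -invr_gt0; lra.
have psi1 : 1 <= psi (Re_rv p.1).
  by rewrite psiE; apply: mulr_ege1 => //; lra.
apply: le_trans (_ : cabs (f p - g p) <= _).
  by rewrite ler_piMl ?cabs_ge0// exprn_ile1 ?cabs_ge0.
by apply: le_trans (fe p Vp dc pc xc) _; rewrite ler_peMr ?(ltW e0).
Qed.

(** A filter on the image is pulled back to the ball and refined to an ultrafilter [F]. The Montel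
    limit [g] of [F] stays in the ball, and [T g] is a cluster point of the given filter. *)
Lemma restrict_H_ball_compact M : compact (T @` [set f : H O n phi | H_norm f <= M]).
Proof.
move=> G PG GM.
pose B (U : set (H O n.+1 psi)) := [set f : H O n phi | H_norm f <= M /\ U (T f)].
have PB : ProperFilter (filter_from G B).
  apply: filter_from_proper => [|U GU].
    apply: filter_from_filter; first by exists setT; exact: filterT.
    move=> U U' GU GU'; exists (U `&` U'); first exact: filterI.
    by move=> f [fM [fU fU']].
  by have [_ [[f fM <-] Uf]] := filter_ex (filterI GM GU); exists f.
have [F [UF BF]] := ultraFilterLemma PB.
have FU U : G U -> F (B U) by move=> GU; apply: BF; exists U.
have FM : F [set f | H_norm f <= M].
  by apply: filterS (FU _ (filterT : G setT)) => f [].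
have [g [gM gP]] := montel_limit n_ge1 Omega_open UF FM.
exists (T g); split; first by exists g.
move=> U N GU /nbhs_nrmP[e e0 eN].
have e2 : 0 < e / 2 by rewrite divr_gt0.
have [f [[fM fU] fg]] := filter_ex (filterI (FU U GU) (restrict_H_cvg UF FM gM gP e2)).
exists (T f); split=> //; apply: eN; rewrite nrm_H.
by apply: le_lt_trans fg _; lra.
Qed.

End CompactRestriction.

Theorem theorem2 (R : realType) (k : nat) (Omega : set 'rV[R]_k)
  (Omega_open : open Omega) (Omega_connected : connected Omega)
  (O : admissible_seq Omega) (n : nat) (n_ge1 : (1 <= n)%N)
  (phi : weight Omega) :
  exists (psi : weight Omega) (T : {linear H O n phi -> H O n.+1 psi}),
    (forall (f : H O n phi) p, dom_V O n.+1 p -> T f p = f p) /\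
    compact_operator T.
Proof.
have [psi psiE] := exhaust_weight phi Omega_open.
have phi_le_psi x : Omega x -> phi x <= psi x.
  move=> Ox; rewrite psiE; have := exhaust_ge1 Ox Omega_open.
  have x0 := weight_gt0 phi Ox => ex1.
  by apply: (@le_trans _ _ (1 + phi x)); [lra|rewrite ler_peMr//; lra].
pose T0 : H O n phi -> H O n.+1 psi := restrict_H n_ge1 Omega_open phi_le_psi.
pose T := HB.pack_for {linear H O n phi -> H O n.+1 psi} T0
  (GRing.isLinear.Build _ _ _ _ T0 (restrict_H_linear n_ge1 Omega_open phi_le_psi)).
exists psi, T; split; first by move=> f p; exact: restrict_HE.
(* [bounded_set] gives a bound by every scalar above [M0], in particular [M0 + 1]; its real part
   then bounds [H_norm]. *)
move=> A [M0 [M0r AM]].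
have M1 : M0 < M0 + 1 by rewrite ltrDl.
have AB f : A f -> H_norm f <= complex.Re (M0 + 1).
  by move=> /(AM _ M1) /=; rewrite H_normE lecE => /andP[].
have cK : compact (T0 @` [set f | H_norm f <= complex.Re (M0 + 1)]).
  exact: restrict_H_ball_compact.
apply: (subclosed_compact _ cK); first exact: closed_closure.
(* The image of the ball is compact, hence closed, so it contains the closure of the image of
   [A]. *)
have /closure_id -> := compact_closed (@norm_hausdorff _ _) cK.
by apply: closureS => _ [f Af <-]; exists f => //; exact: AB.
Qed.
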